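(* For all $d\ge2$, $1\le q\le\infty$, $a>0$ and $b\in\mathbb R$, $$\varepsilon_k(\mathbf W^{a,b}_q,L_q)\asymp\varepsilon_k(\bar{\mathbf W}^{a,b}_q,L_q)\asymp k^{-a}(\log k)^{(d-1)(a+b)},\qquad k\ge2.$$
   Context: Functions are complex-valued and $2\pi$-periodic in each of $d$ variables; $L_p=L_p(\mathbb T^d)$ with respect to the normalized measure $(2\pi)^{-d}d\mathbf x$; $\hat f(\mathbf k)=(2\pi)^{-d}\int_{\mathbb T^d}f(\mathbf x)e^{-i(\mathbf k,\mathbf x)}d\mathbf x$. For $\mathbf s\in\mathbb Z_+^d$ (nonnegative integer coordinates) let $\rho(\mathbf s)=\{\mathbf k\in\mathbb Z^d:[2^{s_j-1}]\le|k_j|<2^{s_j},\ j=1,\dots,d\}$, where $[\cdot]$ is the integer part. Put $\|\mathbf s\|_1=s_1+\dots+s_d$, $Q_n=\bigcup_{\|\mathbf s\|_1\le n}\rho(\mathbf s)$, and let $\mathcal T(Q_n)$ be the space of trigonometric polynomials with frequencies in $Q_n$. For $f\in L_1$ let $\delta_{\mathbf s}(f)=\sum_{\mathbf k\in\rho(\mathbf s)}\hat f(\mathbf k)e^{i(\mathbf k,\mathbf x)}$ and $f_l=\sum_{\|\mathbf s\|_1=l}\delta_{\mathbf s}(f)$, $l=0,1,2,\dots$. Classes: $\mathbf W^{a,b}_q=\{f\in L_1:\|f_l\|_q\le 2^{-al}(\bar l)^{(d-1)b}\text{ for all } l\ge0\}$, $\bar l=\max(l,1)$; and $\bar{\mathbf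 W}^{a,b}_q$ is the set of functions $f=\sum_{n=1}^\infty t_n$ (convergence in $L_q$) with $t_n\in\mathcal T(Q_n)$, $\|t_n\|_q\le2^{-an}n^{b(d-1)}$. Entropy numbers: for a subset $A$ of a Banach space $X$, $\varepsilon_k(A,X)=\inf\{\varepsilon:\exists y^1,\dots,y^{2^k}\in X,\ A\subseteq\bigcup_{j=1}^{2^k}B_X(y^j,\varepsilon)\}$, where $B_X(y,r)=\{x\in X:\|x-y\|\le r\}$. $A_k\ll B_k$ means $A_k\le CB_k$ for all $k$ with $C$ independent of $k$ (it may depend on the other parameters); $A_k\asymp B_k$ means $A_k\ll B_k$ and $B_k\ll A_k$. *)

(* Defs.v *)
From HB Require Import structures.
From mathcomp Require Import all_boot all_order all_algebra.
From mathcomp Require Import complex.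
From mathcomp Require Import all_classical all_reals all_analysis.

Set Implicit Arguments.
Unset Strict Implicit.
Unset Printing Implicit Defensive.

Import Order.TTheory GRing.Theory Num.Theory.
Import numFieldNormedType.Exports.

Local Open Scope classical_set_scope.
Local Open Scope complex_scope.
Local Open Scope ring_scope.

(* The domain of the functions is R^d, encoded as d.-tuple R with its product
   (Borel) sigma-algebra. A function on the torus is a function on R^d that is
   2 pi-periodic in each variable; integrals are taken against the normalized
   Lebesgue measure of [0, 2 pi]^d, i.e. the d-fold product of the uniform
   probability on [0, 2 pi]. *)

Section TorusMeasure.
Variable R : realType.

Lemma two_pi_gt0 : 0 < 2 * pi :> R.
Proof. by rewrite mulr_gt0 // pi_gt0. Qed.

Definition tuple_cons (n : nat) (xy : measurableTypeR R * n.-tuple R) : n.+1.-tuple R :=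
  [tuple of xy.1 :: xy.2].

Lemma measurable_tuple_cons (n : nat) :
  measurable_fun [set: measurableTypeR R * n.-tuple R] (@tuple_cons n).
Proof. exact: measurable_cons. Qed.

HB.instance Definition _ (n : nat) :=
  isMeasurableFun.Build _ _ _ _ (@tuple_cons n) (@measurable_tuple_cons n).

Fixpoint torus_measure (d : nat) : probability (d.-tuple R) R :=
  match d with
  | 0 => dirac ([tuple] : 0.-tuple R)
  | n.+1 =>
      distribution (uniform_prob two_pi_gt0 \x torus_measure n)%E (@tuple_cons n)
  end.

End TorusMeasure.

Section TorusFunctions.
Variables (R : realType) (d : nat).
Implicit Types (f : d.-tuple R -> R[i]) (q : \bar R) (x : d.-tuple R).
Implicit Types (k : {ffun 'I_d -> int}) (s : {ffun 'I_d -> nat}).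

Local Notation mu := (torus_measure R d).

Definition shift_coord (j : 'I_d) (h : R) x : d.-tuple R :=
  [tuple (if i == j then tnth x i + h else tnth x i) | i < d].

Definition periodic f := forall j x, f (shift_coord j (2 * pi) x) = f x.

Definition cmeasurable f :=
  measurable_fun setT (fun x => complex.Re (f x)) /\
  measurable_fun setT (fun x => complex.Im (f x)).

Definition cintegral f : R[i] :=
  (\int[mu]_x complex.Re (f x)) +i* (\int[mu]_x complex.Im (f x)).

Definition normLp q f : \bar R := Lnorm mu q (fun x => (Normc.normc (f x))%:E).

(* Functions are not identified when equal almost everywhere, so normLp q is
   only a seminorm on Lp q; this affects none of the notions below. *)
Definition Lp q : set (d.-tuple R -> R[i]) :=
  [set f | [/\ periodic f, cmeasurable f & (normLp q f < +oo)%E]].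

Definition dot k x : R := \sum_(j < d) (k j)%:~R * tnth x j.

Definition cexpi (t : R) : R[i] := cos t +i* sin t.

Definition fourier_coef f k : R[i] :=
  cintegral (fun x => f x * cexpi (- dot k x)).

(* 2 ^ s %/ 2 is the integer part of 2 ^ (s - 1), including s = 0. *)
Definition rho s : set {ffun 'I_d -> int} :=
  [set k | forall j, (2 ^ s j %/ 2 <= `|k j| < 2 ^ s j)%N].

Definition norm1 s : nat := (\sum_(j < d) s j)%N.

Definition Q (n : nat) : set {ffun 'I_d -> int} :=
  \bigcup_(s in [set s | (norm1 s <= n)%N]) rho s.

Definition trig_poly (K : set {ffun 'I_d -> int}) : set (d.-tuple R -> R[i]) :=
  [set t | exists c : {ffun 'I_d -> int} -> R[i],
     t = fun x => \sum_(k \in K) c k * cexpi (dot k x)].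

Definition delta s f : d.-tuple R -> R[i] :=
  fun x => \sum_(k \in rho s) fourier_coef f k * cexpi (dot k x).

Definition layer (l : nat) f : d.-tuple R -> R[i] :=
  fun x => \sum_(s \in [set s | norm1 s = l]) delta s f x.

Definition W (a b : R) q : set (d.-tuple R -> R[i]) :=
  [set f | Lp 1%E f /\
     forall l : nat, (normLp q (layer l f) <=
       (2 `^ (- (a * l%:R)) * (maxn l 1)%:R `^ ((d%:R - 1) * b))%:E)%E].

Definition Wbar (a b : R) q : set (d.-tuple R -> R[i]) :=
  [set f | Lp q f /\ exists t : nat -> d.-tuple R -> R[i],
     (forall n : nat, (1 <= n)%N -> trig_poly (Q n) (t n) /\
        (normLp q (t n) <=
          (2 `^ (- (a * n%:R)) * n%:R `^ (b * (d%:R - 1)))%:E)%E) /\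
     (fun m : nat => normLp q (f - \sum_(1 <= n < m.+1) t n)) @ \oo --> 0%E].

End TorusFunctions.

(* The space X is given by its carrier, a set in an ambient group V, and its
   (semi)norm N. The centers are indexed by 'I_(2 ^ k) and may repeat. *)
Definition entropy_number (R : realType) (V : zmodType) (X : set V)
    (N : V -> \bar R) (A : set V) (k : nat) : \bar R :=
  ereal_inf [set e%:E | e in [set e : R | exists y : 'I_(2 ^ k) -> V,
    (forall j, X (y j)) /\
    A `<=` \bigcup_j [set x | X x /\ (N (x - y j)%R <= e%:E)%E]]].

Definition entropy_Lp (R : realType) (d : nat) (q : \bar R)
    (A : set (d.-tuple R -> R[i])) (k : nat) : \bar R :=
  entropy_number (Lp q) (normLp q) A k.

Definition dominated_from (R : realType) (k0 : nat) (u v : nat -> \bar R) :=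
  exists C : R, 0 < C /\
    forall k : nat, (k0 <= k)%N -> (u k <= C%:E * v k)%E.

Definition equivalent_from (R : realType) (k0 : nat) (u v : nat -> \bar R) :=
  dominated_from k0 u v /\ dominated_from k0 v u.

(* Main.v *)
Require Import Defs.
From HB Require Import structures.
From mathcomp Require Import all_boot all_order all_algebra finmap.
From mathcomp Require Import complex.
From mathcomp Require Import all_classical all_reals all_analysis.
From mathcomp Require Import measurable_realfun ess_sup_inf.
From mathcomp Require Import zify ring lra.

(* Write each function of either class as a sum of trigonometric polynomials
   t_n with frequencies in Q_n and norm at most w_n ~ 2^(-an) n^((d-1)b). The
   real dimension of T(Q_n) is of order 2^n n^(d-1), and a ball of a D-dimensional
   normed space is covered by 16^(D e) balls with radius 2^e times smaller. Fix m
   with 2^m m^(d-1) a small multiple of k, cover the n-th ball with e = J (m - n), where J > a + 1,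
   for n <= m, and discard the layers n > m: the covering has at most 2^k elements
   and its radius is of order w_m ~ k^(-a) (log k)^((d-1)(a+b)). Conversely both
   classes contain the ball of radius w_n in the space spanned by the n-th layer
   of frequencies, and for n = m + O(1) this space has real dimension larger than
   k, so that a ball of dimension D cannot be covered by 2^k < 2^D balls whose
   radius is a small multiple of its own.

   A function f of the class W is only known to be integrable. The sum of its
   layers converges absolutely in L_1 and almost everywhere, and the sum equals f
   by the uniqueness of Fourier coefficients; Fatou's lemma then bounds the L_q
   norms of the remainders. *)

Set Implicit Arguments.
Unset Strict Implicit.
Unset Printing Implicit Defensive.
Import Order.TTheory GRing.Theory Num.Theory.
Import numFieldNormedType.Exports.
Local Open Scope classical_set_scope.
Local Open Scope ring_scope.

(** * Frequency blocks *)

(** Besides the axioms of a seminorm, the counting uses only that Fourier coefficients are bounded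
    by the L_q norm; hence q = 1 and q = +oo need no bounded projection onto the layers. W
    prescribes the norms of its layers, Wbar those of its terms, and the small balls used from below
    consist of polynomials with a single nonzero layer, equal to the polynomial itself. Refining the
    coarse layers loses no logarithm: the sum over n <= m of 2^n (m - n) is O(2^m), so all
    refinements together cost the order of one layer. The n-th radius w_n 2^(-J (m - n)) is at most
    w_m 2^(-(J - a)(m - n)) times a power of m - n + 1, and the size of J makes these sum to O(w_m).
    The exponent (d-1)(a+b) arises on eliminating 2^m: if k ~ 2^m m^(d-1), then 2^(-am) ~ k^(-a)
    m^((d-1)a), and m ~ log k. The centres of a covering range over all of L_q, outside the
    finite-dimensional space; the lower bound therefore compares two points of one ball with each
    other and never projects a centre. *)

Definition dyadic_elt (s r : nat) : int :=
  if (r < 2 ^ s %/ 2)%N then (2 ^ s %/ 2 + r)%N%:Z else - r%:Z.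

(** Small [r] give the positive half of the block, shifted by 2^s/2; the other [r] already have the
    right modulus and are negated. For s = 0 the first half is empty and only 0 remains. *)
Lemma dyadic_elt_range s r : (r < 2 ^ s)%N ->
  (2 ^ s %/ 2 <= `|dyadic_elt s r| < 2 ^ s)%N.
Proof. by rewrite /dyadic_elt; case: ifPn => h h'; lia. Qed.

Lemma dyadic_elt_inj s r r' : (r < 2 ^ s)%N -> (r' < 2 ^ s)%N ->
  dyadic_elt s r = dyadic_elt s r' -> r = r'.
Proof. by rewrite /dyadic_elt; do 2 case: ifPn => ?; lia. Qed.

Lemma dyadic_elt_surj s (k : int) : (2 ^ s %/ 2 <= `|k| < 2 ^ s)%N ->
  exists2 r, (r < 2 ^ s)%N & dyadic_elt s r = k.
Proof.
move=> h; have [k0|k0] := lerP k 0.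
  exists `|k|%N; first by lia.
  by rewrite /dyadic_elt; case: ifPn => ?; lia.
exists (`|k| - 2 ^ s %/ 2)%N; first by lia.
rewrite /dyadic_elt; case: ifPn => ?; last first.
  (* Integer halving is exact except at s = 0; either way a positive [k] of the block cannot have
     its shifted index beyond the first half. *)
  have : (2 ^ s = 1 \/ 2 ^ s = 2 * (2 ^ s %/ 2))%N.
    case: (s) => [|t]; [by left|right; rewrite expnS; lia].
  by lia.
by lia.
Qed.

Lemma dyadic_level_uniq s t (a : nat) : (2 ^ s %/ 2 <= a < 2 ^ s)%N ->
  (2 ^ t %/ 2 <= a < 2 ^ t)%N -> s = t.
Proof.
wlog st : s t / (s < t)%N => [hw|].
  case: (ltngtP s t) => // h h1 h2; first exact: hw.
  by apply/esym; exact: hw.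
case: t st => // t; rewrite ltnS => st /andP[_ h1] /andP[h2 _].
have : (2 ^ s <= 2 ^ t)%N by rewrite leq_exp2l.
by move: h2; rewrite expnS; lia.
Qed.

Section Blocks.
Variable d : nat.
Implicit Types (k : {ffun 'I_d -> int}) (s : {ffun 'I_d -> nat}).

(** The index is a dependent finite function because the number of choices 2^(s j) varies with [j];
    the cardinality is then the product of these powers. *)
Definition rho_seq s : seq {ffun 'I_d -> int} :=
  [seq [ffun j => dyadic_elt (s j) (f j)] | f : {dffun forall j : 'I_d, 'I_(2 ^ s j)}].

Lemma mem_rho_seq s k : k \in rho_seq s <-> rho s k.
Proof.
split=> [/mapP[f _ ->] j|ks]; first by rewrite ffunE; exact: dyadic_elt_range.
have h j : {r : 'I_(2 ^ s j) | dyadic_elt (s j) r = k j}.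
  apply: cid; have [r rs e] := dyadic_elt_surj (ks j).
  by exists (Ordinal rs).
apply/mapP; exists [ffun j => sval (h j)]; first by rewrite mem_enum.
by apply/ffunP => j; rewrite !ffunE; case: (h j).
Qed.

Lemma uniq_rho_seq s : uniq (rho_seq s).
Proof.
rewrite map_inj_uniq ?enum_uniq// => f g /ffunP fg.
apply/ffunP => j; apply/val_inj; have := fg j; rewrite !ffunE.
exact: dyadic_elt_inj.
Qed.

Lemma size_rho_seq s : size (rho_seq s) = (2 ^ norm1 s)%N.
Proof.
rewrite size_map -cardE card_dep_ffun /norm1 expn_sum.
by rewrite foldrE big_map big_enum /=; apply: eq_bigr => j _; rewrite card_ord.
Qed.

Lemma rho_uniq s t k : rho s k -> rho t k -> s = t.
Proof. by move=> ks kt; apply/ffunP => j; exact: dyadic_level_uniq (ks j) (kt j). Qed.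

End Blocks.

(** * Counting the levels and the frequencies of a layer *)

Section Counting.
Variable d' : nat.
Local Notation d := d'.+1.

(** Coordinate 0 is what the other d - 1 coordinates leave of [n]. The subtraction is truncated, so
    a choice with sum above [n] has the wrong norm and is filtered out in [levels]. The cap B = n
    reaches every level, a smaller cap serves for the lower count. *)
Definition complete_to (n B : nat) (g : {ffun 'I_d' -> 'I_B.+1}) : {ffun 'I_d -> nat} :=
  [ffun j => if unlift ord0 j is Some i then g i : nat else (n - \sum_i g i)%N].

Lemma norm1_complete_to n B (g : {ffun 'I_d' -> 'I_B.+1}) :
  (\sum_i g i <= n)%N -> norm1 (complete_to n g) = n.
Proof.
move=> gn; have E : (\sum_(i < d') complete_to n g (lift ord0 i) = \sum_i g i)%N.
  by apply: eq_bigr => i _; rewrite ffunE liftK.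
by rewrite /norm1 big_ord_recl ffunE unlift_none E subnK.
Qed.

Lemma complete_to_inj n B : injective (@complete_to n B).
Proof.
move=> g h /ffunP gh; apply/ffunP => i; have := gh (lift ord0 i).
by rewrite !ffunE liftK => /val_inj.
Qed.

Lemma complete_to_surj (s : {ffun 'I_d -> nat}) :
  exists g, s = @complete_to (norm1 s) (norm1 s) g.
Proof.
exists [ffun i => inord (s (lift ord0 i))].
have sE i : (inord (s (lift ord0 i)) : 'I_(norm1 s).+1) = s (lift ord0 i) :> nat.
  by rewrite inordK// ltnS /norm1 (bigD1 (lift ord0 i)) //= leq_addr.
apply/ffunP => j; rewrite ffunE; case: unliftP => [i ->|->]; first by rewrite ffunE sE.
under eq_bigr do rewrite ffunE sE.
by rewrite /norm1 big_ord_recl addnK.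
Qed.

Definition levels (n : nat) : seq {ffun 'I_d -> nat} :=
  [seq s <- [seq complete_to n g | g : {ffun 'I_d' -> 'I_n.+1}] | norm1 s == n].

Lemma mem_levels n (s : {ffun 'I_d -> nat}) : s \in levels n <-> norm1 s = n.
Proof.
rewrite mem_filter; split=> [/andP[/eqP//]|<-]; rewrite eqxx /=.
have [g sg] := complete_to_surj s.
by rewrite [X in X \in _]sg; apply: map_f; rewrite mem_enum.
Qed.

Lemma uniq_levels n : uniq (levels n).
Proof.
by apply: filter_uniq; rewrite map_inj_uniq ?enum_uniq//; exact: complete_to_inj.
Qed.

Lemma size_levels_le n : (size (levels n) <= n.+1 ^ d')%N.
Proof.
rewrite size_filter; apply: leq_trans (count_size _ _) _.
by rewrite size_map -cardE card_ffun !card_ord.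
Qed.

(** If d - 1 coordinates are chosen freely up to n / d, their sum stays below [n] and coordinate 0
    can make up the difference. *)
Lemma size_levels_ge n : ((n %/ d).+1 ^ d' <= size (levels n))%N.
Proof.
pose B := (n %/ d)%N.
pose S := [seq complete_to n g | g : {ffun 'I_d' -> 'I_B.+1}].
have <- : size S = (B.+1 ^ d')%N by rewrite size_map -cardE card_ffun !card_ord.
apply: uniq_leq_size; first by rewrite map_inj_uniq ?enum_uniq//; exact: complete_to_inj.
move=> s /mapP[g _ ->]; apply/mem_levels; apply: norm1_complete_to.
apply: (@leq_trans (\sum_(i < d') B)).
  by apply: leq_sum => i _; rewrite -ltnS.
rewrite sum_nat_const card_ord (leq_trans _ (leq_divM n d))//.
by rewrite mulnC leq_mul2l leqnSn orbT.
Qed.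

Definition freqs (n : nat) : seq {ffun 'I_d -> int} :=
  [seq k | s <- levels n, k <- rho_seq s].

Lemma mem_freqs n k : k \in freqs n <-> exists2 s, norm1 s = n & rho s k.
Proof.
split=> [/allpairsPdep[s [l [/mem_levels sn /mem_rho_seq ls ->]]]|[s sn ks]].
  by exists s.
by apply/allpairsPdep; exists s, k; split => //; [exact/mem_levels|exact/mem_rho_seq].
Qed.

Lemma uniq_freqs n : uniq (freqs n).
Proof.
apply: allpairs_uniq_dep; first exact: uniq_levels.
  by move=> s _; exact: uniq_rho_seq.
move=> p p' /allpairsPdep[s [k [_ /mem_rho_seq ks pE]]].
move=> /allpairsPdep[t [l [_ /mem_rho_seq lt pE']]]; rewrite {}pE {}pE' /= => kl.
by rewrite -kl in lt *; rewrite (rho_uniq ks lt).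
Qed.

Lemma size_freqs n : size (freqs n) = (size (levels n) * 2 ^ n)%N.
Proof.
rewrite size_allpairs_dep sumnE big_map (eq_big_seq (fun=> 2 ^ n)%N).
  by rewrite big_const_seq count_predT iter_addn_0 mulnC.
by move=> s /mem_levels sn; rewrite size_rho_seq sn.
Qed.

Lemma freqs_disjoint m n k : k \in freqs m -> k \in freqs n -> m = n.
Proof.
move=> /mem_freqs[s <- ks] /mem_freqs[t <- kt].
by rewrite (rho_uniq ks kt).
Qed.

Definition Q_freqs (n : nat) : seq {ffun 'I_d -> int} :=
  undup (flatten [seq freqs l | l <- iota 0 n.+1]).

Lemma mem_Q_freqs n k : k \in Q_freqs n <-> Q n k.
Proof.
rewrite mem_undup; split.
  move=> /flatten_mapP[l ln /mem_freqs[s sl ks]].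
  by exists s => //=; rewrite sl; rewrite mem_iota in ln; lia.
move=> [s sn ks]; apply/flatten_mapP; exists (norm1 s).
  by move: sn; rewrite mem_iota /=; lia.
by apply/mem_freqs; exists s.
Qed.

(** With every polynomial factor replaced by the last one a geometric sum remains, so all layers up
    to [n] together are of the order of the last. *)
Lemma size_Q_freqs n : (size (Q_freqs n) <= n.+1 ^ d' * 2 ^ n.+1)%N.
Proof.
apply: leq_trans (size_undup _) _.
rewrite size_flatten sumnE /shape -map_comp big_map.
apply: (@leq_trans (\sum_(l <- iota 0 n.+1) (n.+1 ^ d' * 2 ^ l))%N).
  rewrite !big_seq; apply: leq_sum => l; rewrite mem_iota => /andP[_ ln].
  rewrite /= size_freqs leq_mul2r; apply/orP; right.
  apply: leq_trans (size_levels_le l) _.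
  by case: (posnP d') => [->//|?]; rewrite leq_exp2r.
rewrite -big_distrr leq_mul2l; apply/orP; right.
have -> : (\sum_(l <- iota 0 n.+1) 2 ^ l = \sum_(l < n.+1) 2 ^ l)%N.
  by rewrite -(big_mkord xpredT (expn 2)) /index_iota subn0.
by have := predn_exp 2 n.+1; rewrite mul1n => <-; exact: leq_pred.
Qed.

End Counting.

(** * Uniqueness of Fourier coefficients *)

Section BoundedIntegrable.
Context d (T : measurableType d) (R : realType) (P : probability T R).

Lemma bounded_integrable (g : T -> R) (B : R) : measurable_fun setT g ->
  (forall x, `|g x| <= B) -> P.-integrable setT (EFin \o g).
Proof.
move=> mg gB; apply: (@le_integrable _ _ _ P _ measurableT _ (EFin \o cst B)).
- exact/measurable_EFinP.
- by move=> x _; rewrite lee_fin (le_trans (gB x))// ler_norm.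
- exact: finite_measure_integrable_cst.
Qed.

Lemma bounded_mul_integrable (f g : T -> R) (B : R) : P.-integrable setT (EFin \o f) ->
  measurable_fun setT g -> (forall x, `|g x| <= B) ->
  P.-integrable setT (EFin \o (fun x => f x * g x)).
Proof.
move=> fi mg gB.
apply: (@le_integrable _ _ _ P _ measurableT _ (fun x => B%:E * (EFin \o f) x)%E).
- apply/measurable_EFinP; apply: measurable_funM => //.
  by apply/measurable_EFinP; case/integrableP: fi.
- move=> x _; by rewrite /= lee_fin !normrM mulrC ler_wpM2r// (le_trans (gB x))// ler_norm.
- by apply: integrableZl.
Qed.

End BoundedIntegrable.

(** * Null sets and integrals of cosines on the torus *)

Section TorusMarginals.
Variable R : realType.

Lemma torus_measureS (d : nat) (A : set (d.+1.-tuple R)) :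
  torus_measure R d.+1 A =
  (uniform_prob (two_pi_gt0 R) \x torus_measure R d)%E (@tuple_cons R d @^-1` A).
Proof. by []. Qed.

Lemma torus_marginal (d : nat) (j : 'I_d) (B : set R) : measurable B ->
  torus_measure R d ((fun x => tnth x j) @^-1` B) = uniform_prob (two_pi_gt0 R) B.
Proof.
elim: d j => [[]//|d IH] j mB; rewrite torus_measureS.
case: (unliftP ord0 j) => [i|] ->.
  have -> : @tuple_cons R d @^-1` ((fun x => tnth x (lift ord0 i)) @^-1` B) =
      setT `*` ((fun x => tnth x i) @^-1` B).
    by apply/seteqP; split=> -[x y] /=; rewrite tnthS// => -[].
  rewrite product_measure1E//; last first.
    by rewrite -[X in measurable X]setTI; exact: measurable_tnth.
  transitivity (1 * uniform_prob (two_pi_gt0 R) B)%E; last by rewrite mul1e.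
  by congr (_ * _)%E; [exact: probability_setT|exact: IH].
have -> : @tuple_cons R d @^-1` ((fun x => tnth x ord0) @^-1` B) = B `*` setT.
  by apply/seteqP; split=> -[x y] /=; rewrite tnth0// => -[].
rewrite product_measure1E//.
transitivity (uniform_prob (two_pi_gt0 R) B * 1)%E; last by rewrite mule1.
by congr (_ * _)%E; exact: probability_setT.
Qed.

Lemma uniform_prob_point (e : R) : uniform_prob (two_pi_gt0 R) [set e] = 0%E.
Proof.
have /null_content_dominatesP := dominates_uniform_prob (two_pi_gt0 R).
by apply => //; exact: lebesgue_measure_set1.
Qed.

Lemma uniform_prob_out : uniform_prob (two_pi_gt0 R) (~` `[0, 2 * pi]) = 0%E.
Proof. by rewrite /uniform_prob integral_uniform_pdf setICl integral_set0. Qed.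

(** The values 0, e and 2 pi are those at which the function [u] of [mset_ray] equals 1/2 and its
    thresholds have no useful limit; this lemma discards them, together with the points outside the
    period. *)
Lemma ae_torus_coord (d : nat) (j : 'I_d) (e : R) :
  \forall x \ae torus_measure R d, 0 < tnth x j < 2 * pi /\ tnth x j <> e.
Proof.
pose N : set R := ~` `[0, 2 * pi] `|` [set 0] `|` [set 2 * pi] `|` [set e].
have mN : measurable N by do !apply: measurableU => //; exact: measurableC.
exists ((fun x => tnth x j) @^-1` N); split.
- by rewrite -[X in measurable X]setTI; exact: measurable_tnth.
- rewrite torus_marginal//.
  pose U : probability (measurableTypeR R) R := uniform_prob (two_pi_gt0 R).
  have U0 : U N = 0%E.
    rewrite /N !measureU0//; try exact: uniform_prob_point; try exact: measurableC.
    - exact: uniform_prob_out.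
    - by apply: measurableU => //; exact: measurableC.
    - by do 2 apply: measurableU => //; exact: measurableC.
  exact: U0.
- move=> x /= h; rewrite /N /=; apply: contrapT => h'; apply: h.
  move: h' => /not_orP[/not_orP[/not_orP[h0 h1] h2] h3]; split=> //.
  move: h0 => /contrapT; rewrite in_itv/= => /andP[a1 a2].
  by rewrite !lt_neqAle a1 a2 !andbT eq_sym; apply/andP; split; apply/eqP.
Qed.

Lemma measurable_dot (d : nat) (k : {ffun 'I_d -> int}) :
  measurable_fun [set: d.-tuple R] (@dot R d k).
Proof.
rewrite /dot; apply: measurable_sum => j; apply: measurable_funM => //.
exact: measurable_tnth.
Qed.

Lemma measurable_cos_dot (d : nat) (k : {ffun 'I_d -> int}) (c : R) :
  measurable_fun [set: d.-tuple R] (fun x => cos (dot k x + c)).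
Proof.
apply: (measurableT_comp (f := @cos R)).
  by apply: continuous_measurable_fun; exact: continuous_cos.
by apply: measurable_funD => //; exact: measurable_dot.
Qed.

Lemma norm_cos_le1 (x : R) : `|cos x| <= 1.
Proof. by rewrite ler_norml cos_geN1 cos_le1. Qed.

Lemma cos_int_periodic (n : int) (x : R) : cos (x + n%:~R * (2 * pi)) = cos x.
Proof.
have -> : 2 * pi = pi *+ 2 :> R by rewrite mulr_natl.
have pos (m : nat) (y : R) : cos (y + m%:R * (pi *+ 2)) = cos y.
  elim: m y => [|m IH] y; first by rewrite mul0r addr0.
  by rewrite -natr1 mulrDl mul1r addrA cosD2pi IH.
case: n => n; first exact: pos.
rewrite NegzE mulrNz mulNr -[in RHS](subrK (n.+1%:~R * (pi *+ 2)) x).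
by rewrite -[n.+1%:~R]/(n.+1%:R) pos.
Qed.

Lemma integral_uniform_cos (n : int) (c : R) : n != 0 ->
  (\int[uniform_prob (two_pi_gt0 R)]_x (cos (n%:~R * x + c))%:E = 0)%E.
Proof.
move=> n0; have n0' : n%:~R != 0 :> R by rewrite intr_eq0.
pose g (x : R) := cos (n%:~R * x + c).
pose U : probability (measurableTypeR R) R := uniform_prob (two_pi_gt0 R).
have cg : continuous g.
  move=> x; apply: continuous_comp; last exact: continuous_cos.
  apply: cvgD; last exact: cvg_cst.
  by apply: cvgM; [exact: cvg_cst|exact: cvg_id].
have mg : measurable_fun setT g by exact: continuous_measurable_fun.
have ig : U.-integrable setT (EFin \o g).
  by apply: (@bounded_integrable _ (measurableTypeR R) R U g 1 mg) => x; exact: norm_cos_le1.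
have i1 : U.-integrable setT (EFin \o @cst R R 1).
  exact: finite_measure_integrable_cst.
(* [integral_uniform] applies to nonnegative functions, so 1 is added to the cosine and subtracted
   afterwards. *)
have E : (\int[uniform_prob (two_pi_gt0 R)]_x (1 + g x)%:E = 1)%E.
  rewrite integral_uniform; last 2 first.
  - by apply/measurable_EFinP; apply: measurable_funD.
  - by move=> x; rewrite lee_fin -lerBlDl sub0r cos_geN1.
  pose F (x : R) := x + (n%:~R)^-1 * sin (n%:~R * x + c).
  have dF (x : R) : is_derive x (1 : R) F (1 + g x).
    rewrite /F /g; apply: is_derive_eq; rewrite /GRing.scale /=.
    by field.
  rewrite (@continuous_FTC2 _ _ F)//.
  - rewrite /F mulr0 add0r add0r.
    have -> : sin (n%:~R * (2 * pi) + c) = sin c.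
      rewrite -!cosBpihalf.
      have -> : n%:~R * (2 * pi) + c - pi / 2 = c - pi / 2 + n%:~R * (2 * pi) by ring.
      by rewrite cos_int_periodic.
    by rewrite -EFinB -EFinM addrK subr0 mulVf// gt_eqF// two_pi_gt0.
  - exact: two_pi_gt0.
  - by apply: continuous_subspaceT => x; apply: cvgD; [exact: cvg_cst|exact: cg].
  - split=> [x _||]; first by case: (dF x).
    + apply: cvg_at_right_filter; apply: differentiable_continuous.
      by apply/derivable1_diffP; case: (dF 0).
    + apply: cvg_at_left_filter; apply: differentiable_continuous.
      by apply/derivable1_diffP; case: (dF (2 * pi)).
  - by move=> x _; rewrite derive1E; case: (dF x).
have : (\int[U]_x ((EFin \o @cst R R 1%R) x + (EFin \o g) x) = 1)%E by exact: E.
rewrite integralD// /= integral_cst// [X in (1 * X)%E]probability_setT mule1.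
have := integrable_fin_num measurableT ig.
by case: (\int[_]_(_ in _) _)%E => //= r _ [] /eqP; rewrite -subr_eq0 addrAC subrr add0r => /eqP ->.
Qed.

(** Induction by Fubini. If the first frequency is 0, the inner integral over the other coordinates
    vanishes by induction; otherwise the first coordinate is integrated first, the others entering
    as a phase. The free phase [c] also covers the sines. *)
Lemma integral_torus_cos (d : nat) (k : {ffun 'I_d -> int}) (c : R) : k != [ffun=> 0] ->
  (\int[torus_measure R d]_x (cos (dot k x + c))%:E = 0)%E.
Proof.
elim: d k c => [|d IH] k c k0.
  by exfalso; move/eqP: k0; apply; apply/ffunP => -[].
have mcos := @measurable_cos_dot d.+1 k c.
pose U : probability (measurableTypeR R) R := uniform_prob (two_pi_gt0 R).
pose k' : {ffun 'I_d -> int} := [ffun i => k (lift ord0 i)].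
have dotE x y : dot k (@tuple_cons R d (x, y)) = (k ord0)%:~R * x + dot k' y.
  rewrite /dot big_ord_recl tnth0; congr (_ + _).
  by apply: eq_bigr => i _; rewrite tnthS ffunE.
pose f (z : R * d.-tuple R) := (cos ((k ord0)%:~R * z.1 + dot k' z.2 + c))%:E.
have fE : (fun x => (cos (dot k x + c))%:E) \o @tuple_cons R d = f.
  by apply/funext => -[x y] /=; rewrite dotE.
have fi : (U \x torus_measure R d)%E.-integrable setT f.
  rewrite -fE; apply: (@bounded_integrable _ _ R (U \x torus_measure R d)%E _ 1) => [|x]; last exact: norm_cos_le1.
  by apply: (measurableT_comp mcos); exact: measurable_tuple_cons.
rewrite (integral_pushforward (@measurable_tuple_cons R d))//; last 2 first.
  exact/measurable_EFinP.
  by rewrite preimage_setT fE.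
rewrite preimage_setT fE.
have [k00|k00] := eqVneq (k ord0) 0.
  rewrite -integral12_prod_meas1// /fubini_F integral0_eq// => x _.
  rewrite /f/= k00 mul0r; under eq_integral do rewrite add0r.
  apply: IH; apply: contra_neq k0 => k'0; apply/ffunP => j; rewrite ffunE.
  case: (unliftP ord0 j) => [i|] -> //.
  by have /ffunP/(_ i) := k'0; rewrite !ffunE.
rewrite -integral21_prod_meas1// /fubini_G integral0_eq// => y _.
rewrite /f/=; under eq_integral do rewrite -addrA.
exact: integral_uniform_cos.
Qed.

End TorusMarginals.

Section Threshold.
Variable R : realType.

(* The powers used by Brosowski and Deutsch: they turn a function into the
   indicator of its values below 1/2 using ring operations only. *)
Definition threshold (n : nat) (u : R) : R := (1 - u ^+ n) ^+ (2 ^ n).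

Lemma threshold_bounds n u : 0 <= u <= 1 -> 0 <= threshold n u <= 1.
Proof.
move=> /andP[u0 u1]; have un1 := exprn_ile1 n u0 u1; have un0 := exprn_ge0 n u0.
by rewrite /threshold exprn_ge0 ?subr_ge0//= exprn_ile1 ?subr_ge0// lerBlDr lerDl.
Qed.

Let bernoulli (t : R) N : 0 <= t -> 1 + N%:R * t <= (1 + t) ^+ N.
Proof.
move=> t0; elim: N => [|N IH]; first by rewrite mul0r addr0 expr0.
rewrite exprSr; have : (1 + N%:R * t) * (1 + t) <= (1 + t) ^+ N * (1 + t).
  by apply: ler_wpM2r => //; lra.
apply: le_trans; rewrite -natr1; have : 0 <= N%:R * t * t by rewrite !mulr_ge0.
by lra.
Qed.

Let bernoulliN (t : R) N : 0 <= t <= 1 -> 1 - N%:R * t <= (1 - t) ^+ N.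
Proof.
move=> /andP[t0 t1]; elim: N => [|N IH]; first by rewrite mul0r subr0 expr0.
rewrite exprSr; have : (1 - N%:R * t) * (1 - t) <= (1 - t) ^+ N * (1 - t).
  by apply: ler_wpM2r => //; lra.
apply: le_trans; rewrite -natr1; have : 0 <= N%:R * t * t by rewrite !mulr_ge0.
by lra.
Qed.

Let pow2 n (u : R) : (2 ^ n)%:R * u ^+ n = (2 * u) ^+ n.
Proof. by rewrite natrX exprMn. Qed.

(** By Bernoulli, (1 - u^n)^(2^n) >= 1 - (2u)^n. *)
Lemma threshold_lt u : 0 <= u < 2^-1 -> threshold n u @[n --> \oo] --> (1 : R).
Proof.
move=> /andP[u0 u2].
have h : 1 - (2 * u) ^+ n @[n --> \oo] --> (1 - 0 : R).
  apply: cvgB; first exact: cvg_cst.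
  by apply: cvg_expr; rewrite ger0_norm; lra.
rewrite subr0 in h; apply: (squeeze_cvgr _ h (cvg_cst _)).
apply: nearW => n.
have u01 : 0 <= u <= 1 by lra.
have /andP[_ ->] := threshold_bounds n u01; rewrite andbT -pow2.
by apply: bernoulliN; rewrite exprn_ge0// exprn_ile1//; lra.
Qed.

(** Multiplied by (1 + u^n)^(2^n) >= (2u)^n, the threshold becomes (1 - u^(2n))^(2^n) <= 1; hence it
    is at most (2u)^(-n). *)
Lemma threshold_gt u : 2^-1 < u <= 1 -> threshold n u @[n --> \oo] --> (0 : R).
Proof.
move=> /andP[u2 u1]; have u0 : 0 < u by lra.
have h : (2 * u)^-1 ^+ n @[n --> \oo] --> (0 : R).
  apply: cvg_expr; rewrite ger0_norm ?invr_ge0; last by lra.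
  by rewrite invf_lt1; lra.
apply: (squeeze_cvgr _ (cvg_cst _) h).
apply: nearW => n.
have u01 : 0 <= u <= 1 by lra.
have /andP[-> _] /= := threshold_bounds n u01.
rewrite exprVn -[leRHS]mul1r ler_pdivlMr ?exprn_gt0//; last by lra.
have un0 := exprn_ge0 n (ltW u0).
apply: (@le_trans _ _ (threshold n u * (1 + u ^+ n) ^+ (2 ^ n))).
  apply: ler_wpM2l; first by have /andP[] := threshold_bounds n u01.
  by rewrite -pow2; apply: le_trans (bernoulli _ un0); rewrite lerDr.
rewrite /threshold -exprMn -subr_sqr expr1n exprn_ile1//.
  by rewrite subr_ge0 !exprn_ile1 ?exprn_ge0//; lra.
by rewrite lerBlDr lerDl exprn_ge0.
Qed.

End Threshold.

(** * Multipliers preserving the vanishing of all Fourier coefficients *)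

Section FourierUniqueness.
Variables (R : realType) (d : nat) (f : d.-tuple R -> R).
Local Notation T := (d.-tuple R).
Local Notation mu := (torus_measure R d).
Hypothesis fi : mu.-integrable setT (EFin \o f).
Implicit Types (g h : T -> R) (k : {ffun 'I_d -> int}).

Let mf : measurable_fun setT f.
Proof. by apply/measurable_EFinP; case/integrableP: fi. Qed.

Definition bmeas g := measurable_fun setT g /\ exists B, forall x, `|g x| <= B.

(* The multipliers contain the cosines of the coordinates and are stable under
   products and bounded a.e. limits; hence they contain the indicator functions of
   all measurable sets, in particular that of [f >= 0]. *)
Definition annihilated g := bmeas g /\
  forall k c, (\int[mu]_x (f x * (g x * cos (dot k x + c)))%:E = 0)%E.

Definition multiplier g := bmeas g /\
  forall h, annihilated h -> annihilated (fun x => h x * g x).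

Let bmeas_cst a : bmeas (cst a).
Proof. by split=> //; exists `|a|. Qed.

Let bmeasD g h : bmeas g -> bmeas h -> bmeas (fun x => g x + h x).
Proof.
move=> [mg [A gA]] [mh [B hB]]; split; first exact: measurable_funD.
by exists (A + B) => x; rewrite (le_trans (ler_normD _ _))// lerD.
Qed.

Let bmeasM g h : bmeas g -> bmeas h -> bmeas (fun x => g x * h x).
Proof.
move=> [mg [A gA]] [mh [B hB]]; split; first exact: measurable_funM.
by exists (A * B) => x; rewrite normrM ler_pM.
Qed.

Let bmeasZ a g : bmeas g -> bmeas (fun x => a * g x).
Proof. exact: (bmeasM (bmeas_cst a)). Qed.

Let bmeas_cos k c : bmeas (fun x => cos (dot k x + c)).
Proof. by split; [exact: measurable_cos_dot|exists 1 => x; exact: norm_cos_le1]. Qed.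

Let bmeas_integrable g : bmeas g -> mu.-integrable setT (fun x => (f x * g x)%:E).
Proof. by move=> [mg [B gB]]; exact: (bounded_mul_integrable fi mg gB). Qed.

Let integral_comb g h a b : bmeas g -> bmeas h ->
  (\int[mu]_x (f x * g x)%:E = 0)%E -> (\int[mu]_x (f x * h x)%:E = 0)%E ->
  (\int[mu]_x (f x * (a * g x + b * h x))%:E = 0)%E.
Proof.
move=> bg bh g0 h0.
under eq_integral do rewrite mulrDr mulrCA [X in _ + X]mulrCA EFinD !EFinM.
have ig := bmeas_integrable bg; have ih := bmeas_integrable bh.
rewrite integralD//=; [|exact: integrableZl|exact: integrableZl].
by rewrite !integralZl// g0 h0 !mule0 adde0.
Qed.

Lemma annihilated_comb g h a b : annihilated g -> annihilated h ->
  annihilated (fun x => a * g x + b * h x).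
Proof.
move=> [bg g0] [bh h0]; split.
  by apply: bmeasD; exact: bmeasZ.
move=> k c; have := integral_comb a b (bmeasM bg (bmeas_cos k c)) (bmeasM bh (bmeas_cos k c)) (g0 k c) (h0 k c).
by congr (_ = _); apply: eq_integral => x _; congr EFin; ring.
Qed.

Lemma multiplier_comb g h a b : multiplier g -> multiplier h ->
  multiplier (fun x => a * g x + b * h x).
Proof.
move=> [bg Mg] [bh Mh]; split; first by apply: bmeasD; exact: bmeasZ.
move=> p Ap; have := annihilated_comb a b (Mg p Ap) (Mh p Ap).
by congr annihilated; apply/funext => x; ring.
Qed.

Lemma multiplier_cst a : multiplier (cst a).
Proof.
split=> // p Ap; have := annihilated_comb a 0 Ap Ap.
by congr annihilated; apply/funext => x /=; ring.
Qed.

Lemma multiplierM g h : multiplier g -> multiplier h -> multiplier (fun x => g x * h x).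
Proof.
move=> [bg Mg] [bh Mh]; split; first exact: bmeasM.
move=> p /Mg/Mh; congr annihilated; by apply/funext => x; rewrite mulrA.
Qed.

Lemma multiplierX g n : multiplier g -> multiplier (fun x => g x ^+ n).
Proof.
move=> Mg; elim: n => [|n IH]; first exact: multiplier_cst.
have := multiplierM Mg IH; congr multiplier; by apply/funext => x; rewrite exprS.
Qed.

Lemma multiplierB1 g : multiplier g -> multiplier (fun x => 1 - g x).
Proof.
move=> Mg; have := multiplier_comb 1 (- 1) (multiplier_cst 1) Mg.
by congr multiplier; apply/funext => x /=; ring.
Qed.

Let shift_freq k (j : 'I_d) (z : int) : {ffun 'I_d -> int} := [ffun i => k i + z * (i == j)%:R].

Let dot_shift_freq k j z (x : T) : dot (shift_freq k j z) x = dot k x + z%:~R * tnth x j.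
Proof.
rewrite /dot (bigD1 j)//= [in RHS](bigD1 j)//= ffunE eqxx mulr1 rmorphD /= mulrDl addrAC.
congr (_ + _ + _); apply: eq_bigr => i /negPf ij.
by rewrite ffunE ij mulr0 addr0.
Qed.

(** The product of two cosines is half the sum of the cosines of frequencies k + e_j and k - e_j;
    annihilation is required at all frequencies and phases so that both terms vanish. *)
Lemma multiplier_cos (j : 'I_d) c0 : multiplier (fun x => cos (tnth x j - c0)).
Proof.
have bc : bmeas (fun x => cos (tnth x j - c0)).
  have := bmeas_cos (shift_freq [ffun=> 0] j 1) (- c0); congr bmeas; apply/funext => x.
  by rewrite dot_shift_freq mul1r /dot big1 ?add0r// => i _; rewrite ffunE mul0r.
split=> // h [bh h0]; split; first exact: bmeasM.
move=> k c.
have := integral_comb 2^-1 2^-1 (bmeasM bh (bmeas_cos (shift_freq k j 1) (c - c0)))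
  (bmeasM bh (bmeas_cos (shift_freq k j (-1)) (c + c0))) (h0 _ _) (h0 _ _).
congr (_ = _); apply: eq_integral => x _; congr EFin; congr (_ * _).
rewrite !dot_shift_freq.
have -> : dot k x + 1%:~R * tnth x j + (c - c0) = (dot k x + c) + (tnth x j - c0) by ring.
have -> : dot k x + (-1)%:~R * tnth x j + (c + c0) = (dot k x + c) - (tnth x j - c0) by ring.
by move: (dot k x + c) (tnth x j - c0) => y z; rewrite cosD cosB; field.
Qed.

(** Dominated convergence: the common bound [B] and a bound [C] of the annihilated function give the
    integrable majorant C B |f|. *)
Lemma multiplier_lim (g_ : nat -> T -> R) g B :
  (forall n, multiplier (g_ n)) -> (forall n x, `|g_ n x| <= B) ->
  measurable_fun setT g -> (forall x, `|g x| <= B) ->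
  (\forall x \ae mu, g_ n x @[n --> \oo] --> g x) -> multiplier g.
Proof.
move=> Mg_ g_B mg gB gcv.
have bg : bmeas g by split=> //; exists B.
split=> // h Ah; have [bh _] := Ah; split; first exact: bmeasM.
move=> k c.
have [mh [C hC]] := bh; have [mc _] := bmeas_cos k c.
pose F n x : \bar R := (f x * (h x * g_ n x * cos (dot k x + c)))%:E.
have F0 n : (\int[mu]_x F n x = 0)%E by have [_] := (Mg_ n).2 h Ah; apply.
have [|||||_ _] := @dominated_convergence _ _ _ mu setT measurableT F
    (fun x => (f x * (h x * g x * cos (dot k x + c)))%:E) (fun x => ((C * B)%:E * `|(f x)%:E|)%E).
- move=> n; have [[mgn _] _] := Mg_ n.
  by apply/measurable_EFinP; do !apply: measurable_funM.
- by apply/measurable_EFinP; do !apply: measurable_funM.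
- apply: filterS gcv => x gx _; apply: cvg_EFin; first exact: nearW.
  apply: cvgM; first exact: cvg_cst.
  apply: cvgM; last exact: cvg_cst.
  by apply: cvgM => //; exact: cvg_cst.
- by apply: integrableZl => //; exact: integrable_abse.
- apply: nearW => x n _; rewrite /F lee_fin !normrM mulrC ler_wpM2r//.
  apply: (@le_trans _ _ (`|h x| * `|g_ n x|)); last by rewrite ler_pM.
  by rewrite ler_piMr// ?mulr_ge0// norm_cos_le1.
- move=> cv; apply/esym; apply: cvg_unique cv => //.
  by rewrite (_ : (fun n => _) = cst 0%E)//; [exact: cvg_cst|apply/funext => n; exact: F0].
Qed.

Definition mset (A : set T) := measurable A /\ multiplier (\1_A : T -> R).

Let norm_indic_le1 (A : set T) x : `|\1_A x : R| <= 1.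
Proof. by rewrite indicE; case: (_ \in _); rewrite ?normr1 ?normr0. Qed.

(** Since multipliers are stable under products, finite unions are available directly and countable
    ones follow by a limit; no detour through a pi-system is made. *)
Lemma mset_sigma_algebra : sigma_algebra setT mset.
Proof.
split.
- split=> //; have := multiplier_cst 0; congr multiplier; apply/funext => x.
  by rewrite indicE in_set0.
- move=> A [mA MA]; rewrite setTD; split; first exact: measurableC.
  have := multiplierB1 MA; congr multiplier; apply/funext => x.
  by rewrite !indicE in_setC; case: (_ \in _); rewrite /= ?subrr ?subr0.
- move=> F mF; have mU : measurable (\bigcup_i F i).
    by apply: bigcupT_measurable => i; exact: (mF i).1.
  split=> //.
  (* This is the indicator of the union of the first [n] sets; at each point it is eventually
     constant. *)
  pose g_ n x : R := 1 - \prod_(i < n) (1 - \1_(F i) x).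
  have Mp n : multiplier (fun x => \prod_(i < n) (1 - \1_(F i) x)).
    elim: n => [|n IH].
      have := multiplier_cst 1; congr multiplier; apply/funext => x; by rewrite big_ord0.
    have := multiplierM IH (multiplierB1 (mF n).2); congr multiplier.
    by apply/funext => x; rewrite big_ord_recr.
  apply: (@multiplier_lim g_ _ 1) => [n|n x||x|].
  + exact: multiplierB1.
  + rewrite /g_ ger0_norm ?subr_ge0 ?lerBlDr ?lerDl.
      by apply: prodr_ge0 => i _; rewrite indicE; case: (_ \in _); rewrite /= ?subrr ?subr0.
    by apply: prodr_ile1 => i _; rewrite indicE; case: (_ \in _); rewrite /= ?subrr ?subr0 ?lexx ?ler01.
  + exact: measurable_indic.
  + exact: norm_indic_le1.
  + apply: nearW => x; have [[i _ Fx]|nF] := pselect ((\bigcup_i F i) x).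
      apply: cvg_near_cst; exists i.+1 => // n /= ni.
      rewrite /g_ (bigD1 (Ordinal ni))//= !indicE !mem_set//; last by exists i.
      by rewrite subrr mul0r subr0.
    apply: cvg_near_cst; apply: nearW => n.
    rewrite /g_ big1 ?subrr ?indicE ?memNset// => i _.
    by rewrite indicE memNset ?subr0// => Fx; apply: nF; exists i.
Qed.

(** For e outside ]0, 2 pi[ the indicator is constant almost everywhere. Otherwise 0 < x < e means
    that x is closer than e/2 to the midpoint e/2, that is cos (x - e/2) > cos (e/2), and
    [threshold] turns this comparison into an indicator. *)
Let mset_ray (j : 'I_d) (e : R) : mset ((fun x => tnth x j) @^-1` `]-oo, e[).
Proof.
set A := (X in mset X).
have mA : measurable A.
  by rewrite -[X in measurable X]setTI; exact: measurable_tnth.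
split=> //; have mi : measurable_fun setT (\1_A : T -> R) by exact: measurable_indic.
have Aae (a : R) : (\forall x \ae mu, \1_A x = a) -> `|a| <= 1 -> multiplier (\1_A).
  move=> ae a1; apply: (@multiplier_lim (fun=> cst a) _ 1) => //.
    by move=> _; exact: multiplier_cst.
  by apply: filterS ae => x ->; exact: cvg_cst.
have [e0|e0] := leP e 0.
  apply: (Aae 0); last by rewrite normr0.
  apply: filterS (ae_torus_coord j e) => x [/andP[x0 _] _].
  by rewrite indicE memNset// /A /= in_itv/=; apply/negP; rewrite -leNgt; lra.
have [e2|e2] := leP (2 * pi) e.
  apply: (Aae 1); last by rewrite normr1.
  apply: filterS (ae_torus_coord j e) => x [/andP[_ x0] _].
  by rewrite indicE mem_set// /A /= in_itv/=; lra.
(* The difference of cosines lies in [-2, 2], so the factor 1/4 keeps [u] in [0, 1]; its sign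
   decides on which side of 1/2 the value falls. *)
pose u x := 2^-1 - 4^-1 * (cos (tnth x j - e / 2) - cos (e / 2)).
have u01 x : 0 <= u x <= 1.
  rewrite /u; have := cos_le1 (tnth x j - e / 2); have := cos_geN1 (tnth x j - e / 2).
  by have := cos_le1 (e / 2); have := cos_geN1 (e / 2); lra.
have Mu : multiplier u.
  have := multiplier_comb 1 (- 4^-1) (multiplier_cst (2^-1 + 4^-1 * cos (e / 2))) (multiplier_cos j (e / 2)).
  by congr multiplier; apply/funext => x; rewrite /u /=; ring.
apply: (@multiplier_lim (fun n x => threshold n (u x)) _ 1) => //.
- move=> n; apply: multiplierX; apply: multiplierB1; exact: multiplierX.
- by move=> n x; have /andP[h1 h2] := threshold_bounds n (u01 x); rewrite ger0_norm.
apply: filterS (ae_torus_coord j e) => x [/andP[x0 x2] xe].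
have p0 := pi_gt0 R.
have epi : e / 2 \in `[0, pi]%R by rewrite in_itv/=; lra.
have [xle|xge] := ltP (tnth x j) e.
  rewrite indicE mem_set/=; last by rewrite /A /= in_itv.
  apply: threshold_lt; have /andP[-> _] := u01 x; rewrite /= /u.
  suff : cos (e / 2) < cos (tnth x j - e / 2) by lra.
  have [h|h] := leP 0 (tnth x j - e / 2).
    by rewrite ltr_cos// ?in_itv/=; lra.
  by rewrite -[X in _ < X]cosN ltr_cos// ?in_itv/=; lra.
have {xge} xgt : e < tnth x j by rewrite lt_neqAle xge andbT eq_sym; apply/eqP.
rewrite indicE memNset/=; last by rewrite /A /= in_itv/=; lra.
apply: threshold_gt; have /andP[_ ->] := u01 x; rewrite andbT /u.
suff : cos (tnth x j - e / 2) < cos (e / 2) by lra.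
have [h|h] := leP (tnth x j - e / 2) pi.
  by rewrite ltr_cos// ?in_itv/=; lra.
(* Beyond pi the angle is reflected to 2 pi - (x - e/2), which lies in [0, pi] and exceeds e/2
   because x < 2 pi. *)
rewrite -[X in X < _]cosN -[X in X < _](cos_int_periodic 1) mul1r ltr_cos// ?in_itv/=; lra.
Qed.

Lemma mset_measurable (A : set T) : measurable A -> mset A.
Proof.
rewrite /measurable /= /g_sigma_preimage; apply: smallest_sub.
  exact: mset_sigma_algebra.
move=> B; rewrite -bigcup_seq => -[j _ [C mC <-]]; rewrite setTI.
move: C mC.
have : sigma_algebra setT [set C : set R | mset ((fun x => tnth x j) @^-1` C)].
  have [h0 hD hU] := mset_sigma_algebra; split => /=.
  - by rewrite preimage_set0.
  - by move=> C mC; rewrite setTD preimage_setC -setTD; exact: hD.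
  - by move=> F mF; rewrite preimage_bigcup; exact: hU.
move=> sa C mC; have {}mC : (@RGenInftyO.G R).-sigma.-measurable C.
  by rewrite -RGenInftyO.measurableE.
apply: (smallest_sub sa _ mC) => _ [e ->] /=.
exact: mset_ray.
Qed.

Lemma fourier_uniqueness :
  (forall k c, (\int[mu]_x (f x * cos (dot k x + c))%:E = 0)%E) ->
  \forall x \ae mu, f x = 0.
Proof.
move=> f0.
pose A : set T := [set x | 0 <= f x].
have mA : measurable A.
  have -> : A = f @^-1` `[0, +oo[ by apply/seteqP; split=> x; rewrite /A /= in_itv/= andbT.
  by rewrite -[X in measurable X]setTI; exact: mf.
have [_ MA] := mset_measurable mA.
have A1 : annihilated (cst 1).
  split=> // k c; rewrite -[RHS](f0 k c); apply: eq_integral => x _.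
  by rewrite /= mul1r.
(* The multiplier 2 1_A - 1 is the sign of [f]; at frequency 0 the vanishing integral is the L_1
   norm of [f]. *)
have Mg := multiplier_comb 2 (- 1) MA (multiplier_cst 1).
have [_ /(_ [ffun=> 0] 0)] := Mg.2 _ A1.
have -> : (\int[mu]_x (f x * (cst 1 x * (2 * \1_A x + -1 * cst 1 x) *
    cos (dot [ffun=> 0] x + 0)))%:E = \int[mu]_x `|(f x)%:E|)%E.
  apply: eq_integral => x _; rewrite /dot big1 => [|i _]; last by rewrite ffunE mul0r.
  rewrite addr0 cos0 mulr1 /= mul1r mulr1; congr EFin; rewrite indicE.
  have [xA|xA] := boolP (x \in A).
    by rewrite ger0_norm; [rewrite /=; ring|have := set_mem xA].
  rewrite ltr0_norm; first by rewrite /=; ring.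
  by rewrite ltNge; apply/negP => h; move: xA; rewrite mem_set.
move/(ae_eq_integral_abs mu measurableT); move=> /(_ (proj2 (measurable_EFinP _ _) mf)).
by apply: filterS => x /(_ I) [].
Qed.

End FourierUniqueness.

(** * Norms and Fourier expansions of complex functions *)

Section LnormProbability.
Context d (T : measurableType d) (R : realType) (P : probability T R).
Implicit Types (u v : T -> R) (p : \bar R).
Local Notation "'N_ p [ f ]" := (Lnorm P p (EFin \o f)).
Local Open Scope ereal_scope.

Let PT : (P : {measure set T -> \bar R}) [set: T] = 1.
Proof. exact: probability_setT. Qed.

Let measurable_pow (f : T -> \bar R) r : measurable_fun [set: T] f ->
  measurable_fun [set: T] (fun x => `|f x| `^ r).
Proof.
move=> mf; apply: (measurableT_comp (measurable_poweR r)).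
exact: measurableT_comp.
Qed.

Let le_poweR r (x y : \bar R) : (0 <= r)%R -> 0 <= x -> x <= y -> x `^ r <= y `^ r.
Proof.
move=> r0 x0 xy; apply: gt0_ler_poweR => //; rewrite in_itv/= leey andbT//.
exact: le_trans xy.
Qed.

Lemma ae_le_Lnorm p u v : 1 <= p -> measurable_fun setT u -> measurable_fun setT v ->
  (\forall x \ae P, (`|u x| <= `|v x|)%R) -> 'N_p[u] <= 'N_p[v].
Proof.
move=> p1 mu mv uv; rewrite unlock; case: p p1 => [r r1| _|//].
- have r0 : (0 <= r)%R by move: r1; rewrite lee_fin; apply: le_trans.
  apply: le_poweR; rewrite ?invr_ge0//; first by apply: integral_ge0 => x _; exact: poweR_ge0.
  apply: ae_ge0_le_integral => //; try (by move=> x _; exact: poweR_ge0); try by apply: measurable_pow; exact/measurable_EFinP.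
  apply: filterS uv => x uvx _.
  by apply: le_poweR => //; rewrite lee_fin.
- rewrite PT lte01; apply: le_ess_sup.
  by apply: filterS uv => x /=; rewrite lee_fin.
Qed.

Lemma Lnorm_scale p u (a : R) : 1 <= p -> measurable_fun setT u ->
  'N_p[(fun x => a * u x)%R] = `|a|%:E * 'N_p[u].
Proof.
move=> p1 mu; rewrite unlock; case: p p1 => [r r1| _|//].
- have r0 : (0 < r)%R by move: r1; rewrite lee_fin; apply: lt_le_trans.
  under eq_integral do rewrite /comp EFinM abseM poweRM//.
  rewrite ge0_integralZl//.
  + rewrite poweRM ?poweR_ge0//.
      by rewrite -poweRrM mulfV ?gt_eqF// poweRe1.
    by apply: integral_ge0 => x _; exact: poweR_ge0.
  + by apply: measurable_pow; exact/measurable_EFinP.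
  + by move=> x _; exact: poweR_ge0.
  + exact: poweR_ge0.
- rewrite PT lte01 -ess_supZl ?PT//.
  by apply: eq_ess_sup; apply: nearW => x /=; rewrite normrM EFinM.
Qed.

Lemma Lnorm_le_cst p u (c : R) : 1 <= p -> (0 <= c)%R -> measurable_fun setT u ->
  (forall x, (`|u x| <= c)%R) -> 'N_p[u] <= c%:E.
Proof.
move=> p1 c0 mu uc; apply: (@le_trans _ _ 'N_p[cst c]).
  apply: ae_le_Lnorm => //; apply: nearW => x.
  by rewrite (le_trans (uc x))// ler_norm.
rewrite unlock; case: p p1 => [r r1| _|//].
- have r0 : (0 < r)%R by move: r1; rewrite lee_fin; apply: lt_le_trans.
  rewrite (eq_integral (cst (`|c%:E| `^ r)))// integral_cst// PT mule1 -poweRrM mulfV ?gt_eqF// poweRe1//.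
  by rewrite /= ger0_norm.
- rewrite PT lte01; apply/ess_supP; apply: nearW => x /=.
  by rewrite ger0_norm.
Qed.

(** For finite p > 1 this is Hölder's inequality against the constant 1, whose norm is 1 under a
    probability; for p = +oo the essential supremum is integrated. *)
Lemma Lnorm1_le_Lnorm p u : 1 <= p -> measurable_fun setT u -> 'N_1[u] <= 'N_p[u].
Proof.
move=> p1 mu; case: p p1 => [r r1| _|//].
- move: r1; rewrite lee_fin le_eqVlt => /predU1P[<-//|r1].
  have r0 : (0 < r)%R by apply: lt_trans r1.
  have := @hoelder _ _ _ P u (cst 1%R) r (r / (r - 1)) mu (measurable_cst _) r0.
  have -> : (u \* cst 1)%R = u by apply/funext => x /=; rewrite mulr1.
  have -> : (EFin \o @cst T R 1%R) = cst 1 by [].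
  have -> : 'N[P]_(r / (r - 1))%:E[cst 1] = 1.
    by rewrite Lnorm_cst1 PT poweR_EFin powR1.
  rewrite mule1; apply.
  + by rewrite divr_gt0// subr_gt0.
  + by rewrite invf_div; field; lra.
- rewrite Lnorm1 [in leRHS]unlock PT lte01.
  set M := ess_sup _ _.
  have M0 : 0 <= M by apply: ess_sup_gee; rewrite ?PT//; apply: nearW => x /=.
  rewrite -[leRHS]mule1 -PT.
  apply: integral_le_bound => //; first exact/measurable_EFinP.
  by have := ess_sup_ge P (abse \o (EFin \o u)); apply: filterS.
Qed.

Let powR_cvg (r : R) (w : R^nat) (l : R) : (0 < r)%R -> (0 < l)%R -> w @ \oo --> l ->
  (w n `^ r)%R @[n --> \oo] --> (l `^ r)%R.
Proof.
move=> r0 l0 wl.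
have h : expR (r * ln (w n)) @[n --> \oo] --> expR (r * ln l).
  apply: continuous_cvg; first exact: continuous_expR.
  apply: cvgM; first exact: cvg_cst.
  by apply: continuous_cvg => //; exact: continuous_ln.
rewrite /powR [in X in _ --> X]gt_eqF//.
apply: cvg_trans h; apply: near_eq_cvg.
have : \forall n \near \oo, (0 < w n)%R by apply: (cvgr_gt _ wl).
by apply: filterS => n wn; rewrite gt_eqF.
Qed.

Let limn_einf_bounds (w : (\bar R)^nat) (c : \bar R) : (forall n, 0 <= w n) ->
  0 <= limn_einf w /\ ((forall n, w n <= c) -> limn_einf w <= c).
Proof.
move=> w0; split=> [|wc]; rewrite limn_einf_lim; [apply: lime_ge|apply: lime_le]; try exact: is_cvg_einfs.
  by apply: nearW => n; apply: le_ereal_inf_tmp => _ [m _ <-].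
by apply: nearW => n; apply: le_trans (wc n); apply: ereal_inf_lbound; exists n => /=.
Qed.

Lemma ae_lim_Lnorm_le p (h_ : nat -> T -> R) (h : T -> R) (B : R) : 1 <= p -> (0 <= B)%R ->
  (forall n, measurable_fun setT (h_ n)) -> measurable_fun setT h ->
  (\forall x \ae P, h_ n x @[n --> \oo] --> h x) ->
  (forall n, 'N_p[h_ n] <= B%:E) -> 'N_p[h] <= B%:E.
Proof.
move=> p1 B0 mh_ mh cvh hB; case: p p1 hB => [r r1| _|//] hB.
- have r0 : (0 < r)%R by move: r1; rewrite lee_fin; apply: lt_le_trans.
  have hB' n : \int[P]_x (`|(h_ n x)%:E| `^ r) <= (B `^ r)%:E.
    rewrite -poweR_Lnorm ?gt_eqF// -poweR_EFin.
    by apply: le_poweR; [exact: ltW|exact: Lnorm_ge0|exact: hB].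
  have : \int[P]_x (`|(h x)%:E| `^ r) <= (B `^ r)%:E.
    apply: (@le_trans _ _ (\int[P]_x limn_einf (fun n => `|(h_ n x)%:E| `^ r))).
      apply: ae_ge0_le_integral => //.
      + by move=> x _; exact: poweR_ge0.
      + by apply: measurable_pow; exact/measurable_EFinP.
      + by move=> x _; apply: (limn_einf_bounds 0 _).1 => n; exact: poweR_ge0.
      + apply: measurableT_comp => //; apply: measurable_fun_limn_esup => n.
        by apply: measurableT_comp => //; apply: measurable_pow; exact/measurable_EFinP.
      apply: filterS cvh => x hx _.
      (* [powR_cvg] passes through the logarithm and needs a positive limit; where the limit is 0
         the nonnegativity of the lower limit suffices. *)
      have [h0|h0] := eqVneq (h x) 0%R.
        rewrite h0 /= normr0 powR0 ?gt_eqF//.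
        by apply: (limn_einf_bounds 0 _).1 => n; rewrite lee_fin powR_ge0.
      have : (`|h_ n x| `^ r)%:E @[n --> \oo] --> (`|h x| `^ r)%:E.
        apply: cvg_EFin; first by apply: nearW.
        by apply: powR_cvg; rewrite ?normr_gt0//; exact: cvg_norm.
      by move=> /cvg_limn_einf_sup[-> _]; exact: lexx.
    apply: le_trans (fatou _ _ _ _) _ => //.
    + by move=> n; apply: measurable_pow; exact/measurable_EFinP.
    + by move=> n x _; exact: poweR_ge0.
    apply: (limn_einf_bounds _ _).2 => // n.
    by apply: integral_ge0 => x _; exact: poweR_ge0.
  rewrite -poweR_Lnorm ?gt_eqF// -poweR_EFin => hle.
  have := @le_poweR (r^-1)%R ('N_r%:E[h] `^ r) (B%:E `^ r).
  rewrite -!poweRrM mulfV ?gt_eqF// !poweRe1 ?Lnorm_ge0// => -> //.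
    by rewrite invr_ge0 ltW.
  exact: poweR_ge0.
- rewrite unlock PT lte01; apply/ess_supP.
  have hB' n : \forall x \ae P, (`|h_ n x| <= B)%R.
    have := hB n; rewrite unlock PT lte01 => /ess_supP.
    by apply: filterS => x /=; rewrite lee_fin.
  have : \forall x \ae P, forall n, (`|h_ n x| <= B)%R by apply/ae_foralln.
  move=> hB''; apply: filterS2 cvh hB'' => x hx hBx /=; rewrite lee_fin.
  have hn : (`|h_ n x| @[n --> \oo] --> `|h x|)%R by exact: cvg_norm.
  rewrite -(cvg_lim (@Rhausdorff R) hn); apply: limr_le; first exact: cvgP hn.
  exact: nearW.
Qed.

End LnormProbability.

(** * Complex functions, their integrals and Fourier coefficients *)

Section ComplexFunctions.
Variables (R : realType) (d : nat).
Local Notation T := (d.-tuple R).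
Local Notation mu := (torus_measure R d).
Implicit Types (f g : T -> R[i]) (q : \bar R) (k : {ffun 'I_d -> int}).
Local Notation Re := complex.Re.
Local Notation Im := complex.Im.
Local Notation normc := Normc.normc.

Let ReM (z w : R[i]) : Re (z * w) = Re z * Re w - Im z * Im w.
Proof. by case: z; case: w. Qed.

Let ImM (z w : R[i]) : Im (z * w) = Re z * Im w + Im z * Re w.
Proof. by case: z; case: w. Qed.

Let ReD (z w : R[i]) : Re (z + w) = Re z + Re w.
Proof. by case: z; case: w. Qed.

Let ImD (z w : R[i]) : Im (z + w) = Im z + Im w.
Proof. by case: z; case: w. Qed.

Let ReN (z : R[i]) : Re (- z) = - Re z.
Proof. by case: z. Qed.

Let ImN (z : R[i]) : Im (- z) = - Im z.
Proof. by case: z. Qed.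

Let complexP (z w : R[i]) : Re z = Re w -> Im z = Im w -> z = w.
Proof. by case: z => a b; case: w => a' b' /= -> ->. Qed.

Let normcE (z : R[i]) : normc z = Num.sqrt (Re z ^+ 2 + Im z ^+ 2).
Proof. by case: z. Qed.

Lemma normc_ge0 (z : R[i]) : 0 <= normc z.
Proof. by rewrite normcE sqrtr_ge0. Qed.

Lemma normRe_le (z : R[i]) : `|Re z| <= normc z.
Proof. by rewrite normcE -sqrtr_sqr ler_wsqrtr// lerDl sqr_ge0. Qed.

Lemma normIm_le (z : R[i]) : `|Im z| <= normc z.
Proof. by rewrite normcE -sqrtr_sqr ler_wsqrtr// lerDr sqr_ge0. Qed.

Lemma normc_cexpi (t : R) : normc (cexpi t) = 1.
Proof. by rewrite normcE /= cos2Dsin2 sqrtr1. Qed.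

Lemma cexpiD (s t : R) : cexpi (s + t) = cexpi s * cexpi t.
Proof. by apply: complexP; rewrite ?ReM ?ImM /= ?cosD ?sinD// addrC [in RHS]addrC; ring. Qed.

Lemma cexpi_periodic (n : int) (t : R) : cexpi (t + n%:~R * (2 * pi)) = cexpi t.
Proof.
rewrite /cexpi cos_int_periodic -!cosBpihalf addrAC.
by rewrite cos_int_periodic.
Qed.

Lemma cmeasurableD f g : cmeasurable f -> cmeasurable g -> cmeasurable (f + g).
Proof.
move=> [f1 f2] [g1 g2]; split.
  by under eq_fun do rewrite fctE ReD; exact: measurable_funD.
by under eq_fun do rewrite fctE ImD; exact: measurable_funD.
Qed.

Lemma cmeasurableM f g : cmeasurable f -> cmeasurable g ->
  cmeasurable (fun x => f x * g x).
Proof.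
move=> [f1 f2] [g1 g2]; split.
  under eq_fun do rewrite ReM.
  by apply: measurable_funB; apply: measurable_funM.
under eq_fun do rewrite ImM.
by apply: measurable_funD; apply: measurable_funM.
Qed.

Lemma cmeasurable_cst (c : R[i]) : cmeasurable (fun _ : T => c).
Proof. by split; exact: measurable_cst. Qed.

Lemma cmeasurableN f : cmeasurable f -> cmeasurable (- f).
Proof.
move=> [f1 f2]; split.
  by under eq_fun do rewrite fctE ReN; exact: measurableT_comp.
by under eq_fun do rewrite fctE ImN; exact: measurableT_comp.
Qed.

Lemma cmeasurableB f g : cmeasurable f -> cmeasurable g -> cmeasurable (f - g).
Proof. by move=> mf mg; apply: cmeasurableD => //; exact: cmeasurableN. Qed.

Lemma cmeasurable_cexpi k : cmeasurable (fun x : T => cexpi (dot k x)).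
Proof.
split; rewrite /=.
  by have := measurable_cos_dot k (0 : R); under eq_fun do rewrite addr0.
have := measurable_cos_dot k (- (pi / 2) : R).
by under eq_fun do rewrite cosBpihalf.
Qed.

Lemma dotN k (x : T) : dot (- k) x = - dot k x.
Proof.
by rewrite /dot -sumrN; apply: eq_bigr => j _; rewrite ffunE rmorphN mulNr.
Qed.

Lemma dotB k l (x : T) : dot (k - l) x = dot k x - dot l x.
Proof.
by rewrite /dot -sumrB; apply: eq_bigr => j _; rewrite !ffunE rmorphB mulrBl.
Qed.

Lemma measurable_normc f : cmeasurable f -> measurable_fun setT (fun x => normc (f x)).
Proof.
move=> [f1 f2]; under eq_fun do rewrite normcE.
apply: (measurableT_comp (f := @Num.sqrt R)).
  by apply: continuous_measurable_fun; exact: sqrt_continuous.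
by apply: measurable_funD; exact: measurable_funX.
Qed.

Lemma normLp_ge0 q f : (0 <= normLp q f)%E.
Proof. exact: Lnorm_ge0. Qed.

Lemma normLpD q f g : (1 <= q)%E -> cmeasurable f -> cmeasurable g ->
  (normLp q (f + g)%R <= normLp q f + normLp q g)%E.
Proof.
move=> q1 mf mg.
have mf' := measurable_normc mf; have mg' := measurable_normc mg.
apply: (le_trans _ (@eminkowski _ _ _ mu _ _ q mf' mg' q1)).
apply: ae_le_Lnorm => //.
- exact: (measurable_normc (cmeasurableD mf mg)).
- exact: measurable_funD.
apply: nearW => x /=; rewrite !ger0_norm ?addr_ge0 ?normc_ge0//.
exact: (@le_normcD R (f x) (g x)).
Qed.

Lemma normLpZ q f (a : R) : (1 <= q)%E -> cmeasurable f ->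
  normLp q (fun x => (a%:C)%C * f x) = (`|a|%:E * normLp q f)%E.
Proof.
move=> q1 mf; have mf' := measurable_normc mf.
have -> : normLp q (fun x => (a%:C)%C * f x) = Lnorm mu q (EFin \o (fun x => `|a| * normc (f x))).
  apply: eq_Lnorm => x /=; rewrite Normc.normcM; congr (_ * _)%:E.
  by rewrite /= expr0n addr0 sqrtr_sqr.
by rewrite Lnorm_scale// normr_id.
Qed.

Lemma normLpN q f : normLp q (- f) = normLp q f.
Proof. by apply: eq_Lnorm => x; rewrite fctE; congr EFin; exact: (@normcN R (f x)). Qed.

Lemma normLpB q f g : (1 <= q)%E -> cmeasurable f -> cmeasurable g ->
  (normLp q (f - g)%R <= normLp q f + normLp q g)%E.
Proof.
by move=> q1 mf mg; rewrite -(normLpN q g); apply: normLpD => //; exact: cmeasurableN.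
Qed.

Lemma normLp0 q : (1 <= q)%E -> normLp q (0 : T -> R[i]) = 0%E.
Proof.
move=> q1; rewrite -(@Lnorm0 _ _ _ mu q); last by rewrite gt_eqF// (lt_le_trans _ q1).
by apply: eq_Lnorm => x; exact: (congr1 EFin (Normc.normc0 R)).
Qed.

Lemma normLp_le_sup q f (c : R) : (1 <= q)%E -> 0 <= c -> cmeasurable f ->
  (forall x, normc (f x) <= c) -> (normLp q f <= c%:E)%E.
Proof.
move=> q1 c0 mf fc; apply: Lnorm_le_cst => //; first exact: measurable_normc.
by move=> x; rewrite ger0_norm ?normc_ge0.
Qed.

Lemma normLp1_le q f : (1 <= q)%E -> cmeasurable f -> (normLp 1 f <= normLp q f)%E.
Proof. by move=> q1 mf; apply: Lnorm1_le_Lnorm => //; exact: measurable_normc. Qed.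

Definition cintegrable f := mu.-integrable setT (EFin \o (fun x => Re (f x))) /\
  mu.-integrable setT (EFin \o (fun x => Im (f x))).

Lemma normLp1_cintegrable f : cmeasurable f -> (normLp 1 f < +oo)%E -> cintegrable f.
Proof.
move=> mf; rewrite /normLp Lnorm1 => fy; have mf' := measurable_normc mf.
have i0 : mu.-integrable setT (fun x => (normc (f x))%:E).
  by apply/integrableP; split => //; exact/measurable_EFinP.
case: mf => f1 f2; split.
  apply: (le_integrable measurableT _ _ i0); first exact/measurable_EFinP.
  by move=> x _; rewrite lee_fin [leRHS]ger0_norm ?normc_ge0 ?normRe_le.
apply: (le_integrable measurableT _ _ i0); first exact/measurable_EFinP.
by move=> x _; rewrite lee_fin [leRHS]ger0_norm ?normc_ge0 ?normIm_le.
Qed.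

Lemma cintegrableD f g : cintegrable f -> cintegrable g -> cintegrable (f + g).
Proof.
move=> [f1 f2] [g1 g2]; split.
  have := integrableD measurableT f1 g1; congr (_.-integrable _ _).
  by apply/funext => x; rewrite /= fctE ReD.
have := integrableD measurableT f2 g2; congr (_.-integrable _ _).
by apply/funext => x; rewrite /= fctE ImD.
Qed.

Lemma cintegrableZ (c : R[i]) f : cintegrable f -> cintegrable (fun x => c * f x).
Proof.
move=> [f1 f2]; split.
  have := integrableD measurableT (integrableZl measurableT (Re c) f1)
    (integrableZl measurableT (- Im c) f2); congr (_.-integrable _ _).
  by apply/funext => x; rewrite /= ReM -EFinD mulNr.
have := integrableD measurableT (integrableZl measurableT (Re c) f2)
  (integrableZl measurableT (Im c) f1); congr (_.-integrable _ _).
by apply/funext => x; rewrite /= ImM -EFinD.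
Qed.

Lemma cintegrable_cexpi k : cintegrable (fun x => cexpi (dot k x)).
Proof.
apply: normLp1_cintegrable; first exact: cmeasurable_cexpi.
apply: (@le_lt_trans _ _ 1%:E); last by rewrite ltry.
apply: normLp_le_sup => // [|x]; first exact: cmeasurable_cexpi.
by rewrite normc_cexpi.
Qed.

Lemma cintegrableM_cexpi f k : cintegrable f -> cintegrable (fun x => f x * cexpi (dot k x)).
Proof.
move=> [f1 f2].
have [mc ms] := cmeasurable_cexpi k.
have bc x : `|Re (cexpi (dot k x : R))| <= 1 by rewrite -(normc_cexpi (dot k x)) normRe_le.
have bs x : `|Im (cexpi (dot k x : R))| <= 1 by rewrite -(normc_cexpi (dot k x)) normIm_le.
have i1 := bounded_mul_integrable f1 mc bc; have i2 := bounded_mul_integrable f2 ms bs.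
have i3 := bounded_mul_integrable f1 ms bs; have i4 := bounded_mul_integrable f2 mc bc.
split.
  have := integrableB measurableT i1 i2; congr (_.-integrable _ _).
  by apply/funext => x; rewrite /= ReM.
have := integrableD measurableT i3 i4; congr (_.-integrable _ _).
by apply/funext => x; rewrite /= ImM.
Qed.

Lemma cintegralD f g : cintegrable f -> cintegrable g ->
  cintegral (f + g) = cintegral f + cintegral g.
Proof.
move=> [f1 f2] [g1 g2]; apply: complexP; rewrite ?ReD ?ImD /=.
  by rewrite -RintegralD//; apply: eq_Rintegral => x _; rewrite fctE ReD.
by rewrite -RintegralD//; apply: eq_Rintegral => x _; rewrite fctE ImD.
Qed.

Lemma cintegralZ (c : R[i]) f : cintegrable f ->
  cintegral (fun x => c * f x) = c * cintegral f.
Proof.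
move=> [f1 f2].
have j1 := integrableZl measurableT (Re c) f1; have j2 := integrableZl measurableT (Im c) f2.
have j3 := integrableZl measurableT (Re c) f2; have j4 := integrableZl measurableT (Im c) f1.
apply: complexP; rewrite ?ReM ?ImM /=.
  rewrite -!RintegralZl// -RintegralB//.
  by apply: eq_Rintegral => x _; rewrite ReM.
rewrite -!RintegralZl// -RintegralD//.
by apply: eq_Rintegral => x _; rewrite ImM.
Qed.

Lemma cintegral_cexpi k : cintegral (fun x : T => cexpi (dot k x)) = (k == 0)%:R.
Proof.
have [->|k0] := eqVneq k 0.
  have e (x : T) : dot (0 : {ffun 'I_d -> int}) x = 0.
    by rewrite /dot big1 => // j _; rewrite ffunE mul0r.
  apply: complexP => /=; under eq_Rintegral do rewrite e.
    by rewrite cos0 Rintegral_cst// mul1r [X in fine X]probability_setT.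
  by rewrite sin0 Rintegral_cst// mul0r.
have z c : \int[mu]_x cos (dot k x + c) = 0.
  by rewrite /Rintegral integral_torus_cos//; apply: contra_neq k0 => ->; apply/ffunP => j; rewrite !ffunE.
apply: complexP => /=.
  by have := z 0; under eq_Rintegral do rewrite addr0.
have := z (- (pi / 2)); by under eq_Rintegral do rewrite cosBpihalf.
Qed.

Lemma fourier_coefE f k : fourier_coef f k = cintegral (fun x => f x * cexpi (dot (- k) x)).
Proof. by rewrite /fourier_coef; congr cintegral; apply/funext => x; rewrite dotN. Qed.

Lemma fourier_coefD f g k : cintegrable f -> cintegrable g ->
  fourier_coef (f + g) k = fourier_coef f k + fourier_coef g k.
Proof.
move=> fi gi; rewrite !fourier_coefE -cintegralD; try exact: cintegrableM_cexpi.
by congr cintegral; apply/funext => x; rewrite !fctE mulrDl.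
Qed.

Lemma fourier_coefN f k : cintegrable f -> fourier_coef (- f) k = - fourier_coef f k.
Proof.
move=> fi; rewrite !fourier_coefE -[RHS]mulN1r -cintegralZ; last exact: cintegrableM_cexpi.
by congr cintegral; apply/funext => x; rewrite !fctE mulN1r mulNr.
Qed.

Definition tpoly (ks : seq {ffun 'I_d -> int}) (c : {ffun 'I_d -> int} -> R[i]) : T -> R[i] :=
  fun x => \sum_(k <- ks) c k * cexpi (dot k x).

Lemma tpoly_cons k ks c :
  tpoly (k :: ks) c = (fun x => c k * cexpi (dot k x)) + tpoly ks c.
Proof. by apply/funext => x; rewrite /tpoly big_cons fctE. Qed.

Lemma cmeasurable_tpoly ks c : cmeasurable (tpoly ks c).
Proof.
elim: ks => [|k ks IH].
  have := cmeasurable_cst 0; congr cmeasurable; apply/funext => x.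
  by rewrite /tpoly big_nil.
rewrite tpoly_cons; apply: cmeasurableD => //; apply: cmeasurableM.
  exact: cmeasurable_cst.
exact: cmeasurable_cexpi.
Qed.

Lemma cintegrable_tpoly ks c : cintegrable (tpoly ks c).
Proof.
elim: ks => [|k ks IH].
  have := cintegrableZ 0 (cintegrable_cexpi 0); congr cintegrable; apply/funext => x.
  by rewrite /tpoly big_nil mul0r.
rewrite tpoly_cons; apply: cintegrableD => //; apply: cintegrableZ.
exact: cintegrable_cexpi.
Qed.

Lemma fourier_coef_tpoly ks c l : uniq ks ->
  fourier_coef (tpoly ks c) l = if l \in ks then c l else 0.
Proof.
elim: ks => [_|k ks IH /= /andP[kks /IH{}IH]].
  rewrite in_nil fourier_coefE; apply: complexP => /=.
    by rewrite /Rintegral integral0_eq// => x _; rewrite /tpoly big_nil mul0r.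
  by rewrite /Rintegral integral0_eq// => x _; rewrite /tpoly big_nil mul0r.
rewrite tpoly_cons fourier_coefD; [|exact/cintegrableZ/cintegrable_cexpi|exact: cintegrable_tpoly].
rewrite IH inE fourier_coefE.
have -> : (fun x => c k * cexpi (dot k x) * cexpi (dot (- l) x)) =
    (fun x => c k * cexpi (dot (k - l) x)) :> (T -> R[i]).
  by apply/funext => x; rewrite -mulrA -cexpiD dotB dotN.
rewrite cintegralZ; last exact: cintegrable_cexpi.
rewrite cintegral_cexpi subr_eq0 [l == k]eq_sym.
have [<-|kl] /= := eqVneq k l; last by rewrite mulr0 add0r.
by rewrite (negPf kks) mulr1 addr0.
Qed.

Lemma cintegral_norm_le f : cmeasurable f -> (normLp 1 f < +oo)%E ->
  (`|Re (cintegral f)|%:E <= normLp 1 f)%E /\ (`|Im (cintegral f)|%:E <= normLp 1 f)%E.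
Proof.
move=> mf fy; have [f1 f2] := normLp1_cintegrable mf fy.
have mf' := measurable_normc mf; move: (mf) => [m1 m2].
rewrite /normLp Lnorm1; split; rewrite /=.
  rewrite EFin_normr_Rintegral//; apply: le_trans (le_abse_integral _ _ _) _ => //.
    exact/measurable_EFinP.
  apply: ge0_le_integral => //=; try by do ?apply: measurableT_comp => //; exact/measurable_EFinP.
  by move=> x _; rewrite lee_fin [leRHS]ger0_norm ?normc_ge0 ?normRe_le.
rewrite EFin_normr_Rintegral//; apply: le_trans (le_abse_integral _ _ _) _ => //.
  exact/measurable_EFinP.
apply: ge0_le_integral => //=; try by do ?apply: measurableT_comp => //; exact/measurable_EFinP.
by move=> x _; rewrite lee_fin [leRHS]ger0_norm ?normc_ge0 ?normIm_le.
Qed.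

(** Multiplication by an exponential preserves the modulus, and the L_1 norm is at most the L_q
    norm. For trigonometric polynomials this says that the norm dominates the real coordinates. *)
Lemma fourier_coef_norm_le q f k : (1 <= q)%E -> cmeasurable f -> (normLp q f < +oo)%E ->
  (`|Re (fourier_coef f k)|%:E <= normLp q f)%E /\
  (`|Im (fourier_coef f k)|%:E <= normLp q f)%E.
Proof.
move=> q1 mf fy; have f1y := le_lt_trans (normLp1_le q1 mf) fy.
have e : normLp 1 (fun x => f x * cexpi (dot (- k) x)) = normLp 1 f.
  by apply: eq_Lnorm => x; rewrite Normc.normcM normc_cexpi mulr1.
rewrite fourier_coefE.
have mfe : cmeasurable (fun x => f x * cexpi (dot (- k) x)).
  by apply: cmeasurableM => //; exact: cmeasurable_cexpi.
have := cintegral_norm_le mfe; rewrite e => /(_ f1y)[h1 h2].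
by split; apply: (le_trans _ (normLp1_le q1 mf)).
Qed.

(** The coefficients at k and -k give four real equations in the integrals of Re f and Im f against
    cos and sin, which force all four to vanish. This passes from complex coefficients to the real
    form used in [fourier_uniqueness]. *)
Lemma fourier_coef_pair0 f k (c : R) : cintegrable f ->
  fourier_coef f k = 0 -> fourier_coef f (- k) = 0 ->
  (\int[mu]_x (Re (f x) * cos (dot k x + c))%:E = 0)%E /\
  (\int[mu]_x (Im (f x) * cos (dot k x + c))%:E = 0)%E.
Proof.
move=> fi /eqP; rewrite fourier_coefE eq_complex /= => /andP[/eqP a1 /eqP a2].
move=> /eqP; rewrite fourier_coefE opprK eq_complex /= => /andP[/eqP a3 /eqP a4].
have [f1 f2] := fi.
have [mc ms] := cmeasurable_cexpi k.
have bc x : `|cos (dot k x : R)| <= 1 by exact: norm_cos_le1.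
have bs x : `|sin (dot k x : R)| <= 1 by rewrite -cosBpihalf norm_cos_le1.
have i1 := bounded_mul_integrable f1 mc bc; have i2 := bounded_mul_integrable f2 ms bs.
have i3 := bounded_mul_integrable f1 ms bs; have i4 := bounded_mul_integrable f2 mc bc.
have e1 : \int[mu]_x (Re (f x) * cos (dot k x)) + \int[mu]_x (Im (f x) * sin (dot k x)) = 0.
  rewrite -RintegralD// -[RHS]a1; apply: eq_Rintegral => x _.
  by rewrite ReM dotN /= cosN sinN mulrN opprK.
have e2 : \int[mu]_x (Im (f x) * cos (dot k x)) - \int[mu]_x (Re (f x) * sin (dot k x)) = 0.
  rewrite -RintegralB// -[RHS]a2; apply: eq_Rintegral => x _.
  by rewrite ImM dotN /= cosN sinN mulrN addrC.
have e3 : \int[mu]_x (Re (f x) * cos (dot k x)) - \int[mu]_x (Im (f x) * sin (dot k x)) = 0.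
  by rewrite -RintegralB// -[RHS]a3; apply: eq_Rintegral => x _; rewrite ReM.
have e4 : \int[mu]_x (Im (f x) * cos (dot k x)) + \int[mu]_x (Re (f x) * sin (dot k x)) = 0.
  by rewrite -RintegralD// -[RHS]a4; apply: eq_Rintegral => x _; rewrite ImM addrC.
have z (h : T -> R) : mu.-integrable setT (EFin \o (fun x => h x * cos (dot k x))) ->
    mu.-integrable setT (EFin \o (fun x => h x * sin (dot k x))) ->
    \int[mu]_x (h x * cos (dot k x)) = 0 -> \int[mu]_x (h x * sin (dot k x)) = 0 ->
    (\int[mu]_x (h x * cos (dot k x + c))%:E = 0)%E.
  move=> j1 j2 z1 z2.
  have j1' := integrableZl measurableT (cos c) j1.
  have j2' := integrableZl measurableT (sin c) j2.
  have E : \int[mu]_x (h x * cos (dot k x + c)) = 0.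
    transitivity (\int[mu]_x (cos c * (h x * cos (dot k x)) - sin c * (h x * sin (dot k x)))).
      by apply: eq_Rintegral => x _; rewrite cosD; ring.
    by rewrite RintegralB// !RintegralZl// z1 z2 !mulr0 subrr.
  have ij : mu.-integrable setT (EFin \o (fun x => h x * cos (dot k x + c))).
    have := integrableB measurableT j1' j2'; congr (_.-integrable _ _).
    by apply/funext => x; rewrite /= cosD -EFinD; congr EFin; ring.
  by have := integrable_fin_num measurableT ij; move/fineK => <-; congr EFin.
by split; apply: z => //; lra.
Qed.

End ComplexFunctions.

(** * Almost everywhere convergence of absolutely convergent series *)

Section SeriesConvergence.
Variables (R : realType) (d : nat).
Local Notation T := (d.-tuple R).
Local Notation mu := (torus_measure R d).

(* An absolutely convergent series in L1 has an a.e. limit; when its Fourier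
   coefficients agree eventually with those of [h], the limit is [h]. *)
Lemma ae_cvg_of_coefs (u a : nat -> T -> R) (h : T -> R) (C : R) :
  (forall l, measurable_fun setT (u l)) -> (forall l, measurable_fun setT (a l)) ->
  (forall l x, `|u l x| <= a l x) ->
  (forall n, (\sum_(l < n) \int[mu]_x (a l x)%:E <= C%:E)%E) ->
  mu.-integrable setT (EFin \o h) ->
  (forall k c, exists m0, forall m, (m0 <= m)%N ->
    (\int[mu]_x ((\sum_(l < m) u l x - h x) * cos (dot k x + c))%:E = 0)%E) ->
  \forall x \ae mu, \sum_(l < m) u l x @[m --> \oo] --> h x.
Proof.
move=> mu_ ma ua aC hi hcoef.
have a0 l x : 0 <= a l x by apply: le_trans (ua l x).
pose h_ m x := \sum_(l < m) u l x.
have mh_ m : measurable_fun setT (h_ m) by apply: measurable_sum.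
have mh : measurable_fun setT h by apply/measurable_EFinP; case/integrableP: hi.
pose G x := (\sum_(l <oo) (a l x)%:E)%E.
have mG : measurable_fun setT G.
  apply: ge0_emeasurable_sum => [l x _ _|l _]; first by rewrite lee_fin.
  exact/measurable_EFinP.
have G0 x : (0 <= G x)%E by apply: nneseries_ge0 => l _ _; rewrite lee_fin.
have iG : mu.-integrable setT G.
  apply/integrableP; split => //.
  under eq_integral do rewrite gee0_abs//.
  rewrite integral_nneseries//; last 2 first.
    by move=> l; exact/measurable_EFinP.
    by move=> l x _; rewrite lee_fin.
  apply: (@le_lt_trans _ _ C%:E); last by rewrite ltry.
  apply: lime_le; first by apply: is_cvg_nneseries => l _ _; apply: integral_ge0 => x _; rewrite lee_fin.
  by apply: nearW => n; rewrite big_mkord.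
have hG m x : ((`|h_ m x|)%:E <= G x)%E.
  apply: (@le_trans _ _ (\sum_(0 <= l < m) (a l x)%:E)%E); last first.
    by apply: nneseries_lim_ge => l _ _; rewrite lee_fin.
  rewrite sumEFin lee_fin big_mkord; apply: le_trans (ler_norm_sum _ _ _) _.
  exact: ler_sum.
(* An upper limit made finite is measurable on the whole torus and equals the sum of the series
   wherever that converges. *)
pose g x := fine (limn_esup (fun m => (h_ m x)%:E)).
have mg : measurable_fun setT g.
  apply: measurableT_comp => //; apply: measurable_fun_limn_esup => m.
  exact/measurable_EFinP.
have cvg_g : \forall x \ae mu, h_ m x @[m --> \oo] --> g x.
  have := integrable_ae measurableT iG; apply: filterS => x /(_ I) Gfin.
  have ca : cvgn (series (fun l => a l x)).
    apply: nondecreasing_is_cvgn.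
      by apply/nondecreasing_seqP => n; rewrite /series /= big_nat_recr//= lerDl.
    exists (fine (G x)) => _ [n _ <-]; rewrite -lee_fin fineK// /series /= -sumEFin.
    by apply: nneseries_lim_ge => l _ _; rewrite lee_fin.
  have cu : cvgn (series (fun l => u l x)).
    by apply: normed_cvg; apply: (series_le_cvg _ _ _ ca) => l /=; [exact: normr_ge0|exact: a0|exact: ua].
  have cu' : h_ m x @[m --> \oo] --> limn (series (fun l => u l x)).
    have -> : (fun m => h_ m x) = series (fun l => u l x).
      by apply/funext => m; rewrite /series /= big_mkord.
    exact: cu.
  suff -> : g x = limn (series (fun l => u l x)) by [].
  rewrite /g; have : (h_ m x)%:E @[m --> \oo] --> (limn (series (fun l => u l x)))%:E.
    by apply: cvg_EFin => //; exact: nearW.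
  by move=> /cvg_limn_einf_sup[_ ->].
have ig : mu.-integrable setT (EFin \o g).
  have [] := @dominated_convergence _ _ _ mu setT measurableT (fun m => EFin \o h_ m) (EFin \o g) G.
  - by move=> m; exact/measurable_EFinP.
  - exact/measurable_EFinP.
  - apply: filterS cvg_g => x gx _; apply: cvg_EFin => //; exact: nearW.
  - exact: iG.
  - by apply: nearW => x m _; exact: hG.
  - by [].
have igh : mu.-integrable setT (EFin \o (fun x => g x - h x)).
  by have := integrableB measurableT ig hi; congr (_.-integrable _ _).
(* The integrals of the partial sums minus [h] against a cosine are eventually 0 and converge to
   that of g - h; uniqueness then applies. *)
have gh0 : \forall x \ae mu, g x - h x = 0.
  apply: (fourier_uniqueness igh) => k c.
  have [|||_ _ cv] := @dominated_convergence _ _ _ mu setT measurableT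
    (fun m x => ((h_ m x - h x) * cos (dot k x + c))%:E)
    (fun x => ((g x - h x) * cos (dot k x + c))%:E) (fun x => (G x + `|(h x)%:E|)%E)
    (fun m => proj2 (measurable_EFinP _ _) (measurable_funM (measurable_funB (mh_ m) mh) (measurable_cos_dot k c)))
    (proj2 (measurable_EFinP _ _) (measurable_funM (measurable_funB mg mh) (measurable_cos_dot k c))).
  - apply: filterS cvg_g => x gx _; apply: cvg_EFin; first exact: nearW.
    apply: cvgM; last exact: cvg_cst.
    by apply: cvgB => //; exact: cvg_cst.
  - by apply: integrableD => //; exact: integrable_abse.
  - apply: nearW => x m _; apply: (@le_trans _ _ (`|h_ m x|%:E + `|h x|%:E)%E); last first.
      by apply: leeD.
    rewrite -EFinD lee_fin normrM; apply: le_trans (ler_normB _ _).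
    by rewrite ler_piMr ?norm_cos_le1.
  have [m0 hm0] := hcoef k c.
  have : (\int[mu]_x ((h_ m x - h x) * cos (dot k x + c))%:E)%E @[m --> \oo] --> 0%E.
    by apply: cvg_near_cst; exists m0 => // m /= mm; exact: hm0.
  exact: cvg_unique cv.
apply: filterS2 cvg_g gh0 => x gx /eqP; rewrite subr_eq0 => /eqP ghx.
by rewrite -ghx.
Qed.

End SeriesConvergence.

(** * Expansion of a function into its layers *)

Section Layers.
Variables (R : realType) (d' : nat).
Local Notation d := d'.+1.
Local Notation T := (d.-tuple R).
Local Notation mu := (torus_measure R d).
Implicit Types (f : T -> R[i]) (q : \bar R).
Local Notation Re := complex.Re.
Local Notation Im := complex.Im.
Local Notation normc := Normc.normc.

Lemma fsbig_freqs (s : seq {ffun 'I_d -> int}) (A : set {ffun 'I_d -> int}) (F : {ffun 'I_d -> int} -> R[i]) :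
  uniq s -> (forall k, k \in s <-> A k) -> \sum_(k \in A) F k = \sum_(k <- s) F k.
Proof.
move=> us sA; have -> : A = [set` s] by apply/seteqP; split=> k /= /sA.
by rewrite -fsbig_seq.
Qed.

Lemma deltaE s f : delta s f = tpoly (rho_seq s) (fourier_coef f).
Proof.
apply/funext => x; rewrite /delta (fsbig_freqs _ (uniq_rho_seq s))// => k.
exact: mem_rho_seq.
Qed.

Lemma layerE l f : layer l f = tpoly (freqs d' l) (fourier_coef f).
Proof.
apply/funext => x; rewrite /layer /tpoly big_allpairs_dep.
transitivity (\sum_(s <- levels d' l) delta s f x).
  have -> : [set s | norm1 s = l] = [set` levels d' l].
    by apply/seteqP; split=> s /= /mem_levels.
  by rewrite -fsbig_seq ?uniq_levels.
by apply: eq_bigr => s _; rewrite deltaE.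
Qed.

Lemma trig_polyE n (t : T -> R[i]) : trig_poly (Q n) t <-> exists c, t = tpoly (Q_freqs d' n) c.
Proof.
by split=> -[c ->]; exists c; apply/funext => x;
  rewrite (@fsbig_freqs (Q_freqs d' n) (Q n) _ (undup_uniq _) (@mem_Q_freqs d' n)).
Qed.

Lemma fourier_coef_layer l f k :
  fourier_coef (layer l f) k = if k \in freqs d' l then fourier_coef f k else 0.
Proof. by rewrite layerE fourier_coef_tpoly ?uniq_freqs. Qed.

Lemma cmeasurable_layer l f : cmeasurable (layer l f).
Proof. by rewrite layerE; exact: cmeasurable_tpoly. Qed.

Lemma cintegrable_layer l f : cintegrable (layer l f).
Proof. by rewrite layerE; exact: cintegrable_tpoly. Qed.

Lemma fourier_coef_sum_layers n f k l : k \in freqs d' l -> (l < n)%N ->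
  fourier_coef (\sum_(i < n) layer i f) k = fourier_coef f k.
Proof.
move=> kl ln.
have i0 : cintegrable (0 : T -> R[i]).
  have := @cintegrable_tpoly R d [::] (fun=> 0 : R[i]); congr cintegrable.
  by apply/funext => x; rewrite /tpoly big_nil.
have iS m : cintegrable (\sum_(i < m) layer i f).
  elim: m => [|m IH]; first by rewrite big_ord0.
  by rewrite big_ord_recr; apply: cintegrableD => //; exact: cintegrable_layer.
suff -> : fourier_coef (\sum_(i < n) layer i f) k = if (l < n)%N then fourier_coef f k else 0 by rewrite ln.
elim: n {ln} => [|n IH].
  rewrite big_ord0 (_ : (0 : T -> R[i]) = tpoly [::] (fun=> 0)).
    by rewrite fourier_coef_tpoly.
  by apply/funext => x; rewrite /tpoly big_nil.
rewrite big_ord_recr fourier_coefD; [|exact: iS|exact: cintegrable_layer].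
rewrite IH.
have kn : (k \in freqs d' n) = (l == n).
  by apply/idP/eqP => [|<-//]; exact: freqs_disjoint kl.
rewrite fourier_coef_layer kn ltnS [(l <= n)%N]leq_eqVlt.
by case: (l =P n) => [->|_]; rewrite ?ltnn ?add0r ?addr0.
Qed.

(* Fatou's lemma replaces the completeness of L_q, so that q = +oo needs no
   separate treatment. *)
Lemma layer_tail q f (w : nat -> R) (C : R) : (1 <= q)%E -> Lp 1%E f ->
  (forall l, (normLp q (layer l f) <= (w l)%:E)%E) ->
  (forall n, \sum_(l < n) w l <= C) ->
  forall m B, (forall n, \sum_(m <= l < m + n) w l <= B) ->
  (normLp q (f - \sum_(l < m) layer l f)%R <= B%:E)%E.
Proof.
move=> q1 [pf mf fy] lw wC m B wB.
have fi := normLp1_cintegrable mf fy.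
have msum (n1 n2 : nat) : cmeasurable (\sum_(n1 <= l < n2) layer l f).
  elim/big_ind : _ => [|g1 g2|l _]; first exact: cmeasurable_cst.
    exact: cmeasurableD.
  exact: cmeasurable_layer.
have isum n : cintegrable (\sum_(i < n) layer i f).
  apply: normLp1_cintegrable; first by rewrite -(big_mkord xpredT (fun l => layer l f)).
  elim: n => [|n IH]; first by rewrite big_ord0 normLp0// ltry.
  rewrite big_ord_recr; apply: le_lt_trans (normLpD _ _ _) _ => //.
  - by rewrite -(big_mkord xpredT (fun l => layer l f)).
  - exact: cmeasurable_layer.
  - rewrite lte_add_pinfty//; apply: (@le_lt_trans _ _ (w n)%:E); last by rewrite ltry.
    by apply: le_trans (lw n); apply: normLp1_le => //; exact: cmeasurable_layer.
have aC n : (\sum_(l < n) \int[mu]_x (normc (layer l f x))%:E <= C%:E)%E.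
  apply: (@le_trans _ _ (\sum_(l < n) (w l)%:E)%E).
    apply: lee_sum => l _; apply: le_trans (lw l).
    apply: le_trans (normLp1_le q1 (cmeasurable_layer l f)).
    rewrite /normLp Lnorm1; apply: ge0_le_integral => //.
    - by move=> x _; rewrite lee_fin normc_ge0.
    - by apply/measurable_EFinP; exact: measurable_normc (cmeasurable_layer l f).
    - by apply: measurableT_comp => //; apply/measurable_EFinP; exact: measurable_normc (cmeasurable_layer l f).
    - by move=> x _; rewrite lee_fin ler_norm.
  by rewrite sumEFin lee_fin.
(* Every frequency lies in some layer, with s_j one more than the integer part of log_2 |k_j| when
   k_j is nonzero; late partial sums thus have the coefficient of [f] at [k]. *)
have level k : exists l, k \in freqs d' l.
  have h j : exists s, (2 ^ s %/ 2 <= `|k j| < 2 ^ s)%N.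
    have [->|k0] := eqVneq (k j) 0; first by exists 0%N.
    have kj : (0 < `|k j|)%N by rewrite absz_gt0.
    exists (trunc_log 2 `|k j|).+1; have /andP[h1 h2] := trunc_log_bounds (isT : 1 < 2)%N kj.
    by rewrite h2 expnS mulKn// h1.
  exists (norm1 [ffun j => xchoose (h j)]); apply/mem_freqs.
  by exists [ffun j => xchoose (h j)] => // j; rewrite ffunE; exact: xchooseP (h j).
have sumE n x : (\sum_(i < n) layer i f) x = \sum_(i < n) layer i f x by rewrite fct_sumE.
have coefs k c : exists m0, forall n, (m0 <= n)%N ->
   (\int[mu]_x ((\sum_(l < n) Re (layer l f x) - Re (f x)) * cos (dot k x + c))%:E = 0)%E /\
   (\int[mu]_x ((\sum_(l < n) Im (layer l f x) - Im (f x)) * cos (dot k x + c))%:E = 0)%E.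
  have [l kl] := level k; have [l' kl'] := level (- k).
  exists (maxn l l').+1 => n; rewrite gtn_max => /andP[ln l'n].
  have := @fourier_coef_pair0 R d (\sum_(i < n) layer i f - f) k c.
  have iN : cintegrable (- f).
    have := cintegrableZ (-1) fi; congr cintegrable; apply/funext => x.
    by rewrite fctE mulN1r.
  rewrite !fourier_coefD// !fourier_coefN//.
  rewrite (fourier_coef_sum_layers _ kl ln) (fourier_coef_sum_layers _ kl' l'n) !subrr.
  move=> /(_ (cintegrableD (isum n) iN) erefl erefl).
  have re x : Re ((\sum_(i < n) layer i f - f) x) = \sum_(l < n) Re (layer l f x) - Re (f x).
    have -> : (\sum_(i < n) layer i f - f) x = (\sum_(i < n) layer i f) x - f x by [].
    by rewrite sumE raddfB raddf_sum.
  have im x : Im ((\sum_(i < n) layer i f - f) x) = \sum_(l < n) Im (layer l f x) - Im (f x).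
    have -> : (\sum_(i < n) layer i f - f) x = (\sum_(i < n) layer i f) x - f x by [].
    by rewrite sumE raddfB raddf_sum.
  by under eq_integral do rewrite re; under [X in _ /\ X = _]eq_integral do rewrite im.
have cvRe : \forall x \ae mu, \sum_(l < n) Re (layer l f x) @[n --> \oo] --> Re (f x).
  apply: (@ae_cvg_of_coefs R d (fun l x => Re (layer l f x)) (fun l x => normc (layer l f x))
    (fun x => Re (f x)) C) => //.
  - by move=> l; have [] := cmeasurable_layer l f.
  - by move=> l; exact: measurable_normc (cmeasurable_layer l f).
  - by move=> l x; exact: normRe_le.
  - by case: fi.
  - by move=> k c; have [m0 h] := coefs k c; exists m0 => n /h[].
have cvIm : \forall x \ae mu, \sum_(l < n) Im (layer l f x) @[n --> \oo] --> Im (f x).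
  apply: (@ae_cvg_of_coefs R d (fun l x => Im (layer l f x)) (fun l x => normc (layer l f x))
    (fun x => Im (f x)) C) => //.
  - by move=> l; have [] := cmeasurable_layer l f.
  - by move=> l; exact: measurable_normc (cmeasurable_layer l f).
  - by move=> l x; exact: normIm_le.
  - by case: fi.
  - by move=> k c; have [m0 h] := coefs k c; exists m0 => n /h[].
have B0 : 0 <= B by have := wB 0%N; rewrite addn0 big_geq.
have mS : cmeasurable (f - \sum_(l < m) layer l f).
  by apply: cmeasurableB => //; rewrite -(big_mkord xpredT (fun l => layer l f)).
(* The moduli of the finite blocks starting at [m] converge almost everywhere to the modulus of the
   remainder, and their norms are at most [B] by the triangle inequality. *)
apply: (@ae_lim_Lnorm_le _ _ _ mu q (fun n x => normc ((\sum_(m <= l < m + n) layer l f) x))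
  (fun x => normc ((f - \sum_(l < m) layer l f) x))) => //.
- by move=> n; exact: measurable_normc (msum _ _).
- exact: measurable_normc.
- apply: filterS2 cvRe cvIm => x cr ci.
  have E n : (\sum_(m <= l < m + n) layer l f) x =
      \sum_(l < m + n) layer l f x - \sum_(l < m) layer l f x.
    rewrite fct_sumE -!(big_mkord xpredT (fun l => layer l f x)).
    by rewrite (@big_cat_nat _ _ _ m 0 (m + n))//= ?leq_addr// addrAC subrr add0r.
  have normcE (z : R[i]) : normc z = Num.sqrt (Re z ^+ 2 + Im z ^+ 2) by case: z.
  under eq_fun do rewrite E normcE.
  have -> : (f - \sum_(l < m) layer l f) x = f x - (\sum_(l < m) layer l f) x by [].
  rewrite normcE sumE; apply: continuous_cvg; first exact: sqrt_continuous.
  have shift (F : nat -> R) (z : R) : F n @[n --> \oo] --> z -> F (m + n)%N @[n --> \oo] --> z.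
    move=> Fz; have -> : (fun n => F (m + n)%N) = [sequence F (n + m)%N]_n.
      by apply/funext => n; rewrite addnC.
    by rewrite cvg_shiftn.
  set S := \sum_(l < m) layer l f x.
  have cR : Re (\sum_(l < m + n) layer l f x - S) @[n --> \oo] --> Re (f x - S).
    rewrite raddfB; under eq_fun do rewrite raddfB raddf_sum.
    apply: cvgB; last exact: cvg_cst.
    exact: (shift (fun n => \sum_(l < n) Re (layer l f x))).
  have cI : Im (\sum_(l < m + n) layer l f x - S) @[n --> \oo] --> Im (f x - S).
    rewrite raddfB; under eq_fun do rewrite raddfB raddf_sum.
    apply: cvgB; last exact: cvg_cst.
    exact: (shift (fun n => \sum_(l < n) Im (layer l f x))).
  by apply: cvgD; rewrite expr2; under eq_fun do rewrite expr2; apply: cvgM.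
- move=> n; apply: (@le_trans _ _ (\sum_(m <= l < m + n) (w l)%:E)%E); last by rewrite sumEFin lee_fin.
  elim: n => [|n IH].
    rewrite addn0 !big_geq//; apply: (@le_trans _ _ (normLp q (0 : T -> R[i]))); first exact: lexx.
    by rewrite normLp0.
  rewrite addnS !big_nat_recr ?leq_addr//=.
  apply: le_trans (normLpD q1 (msum _ _) (cmeasurable_layer _ _)) _.
  exact: leeD.
Qed.

End Layers.

(** * Coverings of balls in finite-dimensional normed spaces *)

Lemma radix_inj (a b : int) (f g J : nat) : (f < J)%N -> (g < J)%N ->
  a * J%:Z + f%:Z = b * J%:Z + g%:Z -> a = b /\ f = g.
Proof.
move=> fJ gJ h.
have ab : a = b.
  have [ab|ab|//] := ltgtP a b; exfalso.
    have : (a + 1) * J%:Z <= b * J%:Z by apply: ler_wpM2r; lia.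
    lia.
  have : (b + 1) * J%:Z <= a * J%:Z by apply: ler_wpM2r; lia.
  lia.
by split=> //; move: h; rewrite ab => /addrI [].
Qed.

Section LatticeCount.
Variables (R : realType) (m : nat) (nu : 'rV[R]_m -> R).
Hypothesis nuD : forall v w : 'rV[R]_m, nu (v + w) <= nu v + nu w.
Hypothesis nuZ : forall (a : R) (v : 'rV[R]_m), nu (a *: v) = `|a| * nu v.
Hypothesis nu_coord : forall (v : 'rV[R]_m) i, `|v 0 i| <= nu v.

Let nu0 : nu 0 = 0.
Proof. by rewrite -(scale0r 0) nuZ normr0 mul0r. Qed.

Let nuN (v : 'rV[R]_m) : nu (- v) = nu v.
Proof. by rewrite -scaleN1r nuZ normrN1 mul1r. Qed.

Let nu_ge0 v : 0 <= nu v.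
Proof.
have : nu (v - v) <= nu v + nu (- v) by exact: nuD.
by rewrite subrr nu0 nuN -mulr2n pmulrn_lge0.
Qed.

Let nuB (v w : 'rV[R]_m) : nu (v - w) <= nu v + nu w.
Proof. by rewrite -(nuN w); exact: nuD. Qed.

(** Comparison constant of [nu] with the maximum norm, used to bound rounding errors. *)
Let L := \sum_i nu (delta_mx 0 i).

Let nu_sup (v : 'rV[R]_m) (c : R) : (forall i, `|v 0 i| <= c) -> nu v <= c * L.
Proof.
move=> vc; rewrite {1}(row_sum_delta v) mulr_sumr.
elim/big_ind2 : _ => [|x1 x2 y1 y2 h1 h2|i _]; first by rewrite nu0.
  by apply: le_trans (nuD _ _) _; exact: lerD.
by rewrite nuZ; apply: ler_wpM2r.
Qed.

Definition latt (e : R) (z : 'rV[int]_m) : 'rV[R]_m := e *: map_mx intr z.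

Let lattD (e : R) (z w : 'rV[int]_m) : latt e (z + w) = latt e z + latt e w.
Proof. by rewrite /latt map_mxD scalerDr. Qed.

Let lattB (e : R) (z w : 'rV[int]_m) : latt e (z - w) = latt e z - latt e w.
Proof. by rewrite /latt map_mxB scalerBr. Qed.

Let lattZ (e : R) (n : nat) z : latt e (z *+ n) = n%:R *: latt e z.
Proof. by apply/rowP => i; rewrite !mxE mulmxnE rmorphMn /= mulrnAr mulr_natl. Qed.

Definition lball (e r : R) : set 'rV[int]_m := [set z | nu (latt e z) <= r].

Let finite_lball (e r : R) : 0 < e -> finite_set (lball e r).
Proof.
move=> e0.
pose B := Num.truncn (r / e).
pose F (f : {ffun 'I_m -> 'I_(B + B).+1}) : 'rV[int]_m :=
  \row_i ((f i)%:Z - B%:Z).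
apply: (@sub_finite_set _ _ (F @` setT)); last exact: finite_image.
move=> z; rewrite /lball /= => zr.
have zB i : (`|z 0%R i| <= B)%N.
  have := le_trans (nu_coord (latt e z) i) zr.
  rewrite !mxE normrM (gtr0_norm e0) mulrC -ler_pdivlMr// => h.
  rewrite /B truncn_ge_nat ?(le_trans _ h)//.
  by rewrite natr_absz intr_norm.
exists [ffun i => inord (absz (z 0 i + B%:Z))] => //.
apply/rowP => i; rewrite !mxE ffunE inordK; have := zB i; lia.
Qed.

Definition lball_seq (e r : R) : seq 'rV[int]_m := fset_set (lball e r).

Let mem_lball_seq (e r : R) z : 0 < e -> (z \in lball_seq e r) = (nu (latt e z) <= r).
Proof. by move=> e0; rewrite in_fset_set; [apply/idP/idP; rewrite inE|exact: finite_lball]. Qed.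

Let uniq_lball_seq e r : uniq (lball_seq e r).
Proof. exact: fset_uniq. Qed.

Let digits (J : nat) (f : {ffun 'I_m -> 'I_J}) : 'rV[int]_m := \row_i (f i)%:Z.

Let nu_digits (e : R) (J : nat) (f : {ffun 'I_m -> 'I_J}) : 0 < e ->
  nu (latt e (digits f)) <= e * J%:R * L.
Proof.
move=> e0; apply: nu_sup => i; rewrite !mxE normrM gtr0_norm// ler_wpM2l ?ltW//.
by rewrite normr_nat ltr_nat.
Qed.

Let mulzn (a : int) (J : nat) : a *+ J = a * J%:Z.
Proof. by rewrite -mulr_natr natz. Qed.

Let card_digits J : size (enum {: {ffun 'I_m -> 'I_J}}) = (J ^ m)%N.
Proof. by rewrite -cardE card_ffun !card_ord. Qed.

(* Counting the points of a fine lattice replaces the comparison of volumes. *)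
Lemma size_lball_dilate (e r1 r2 : R) (J : nat) : 0 < e ->
  J%:R * r2 + e * J%:R * L <= r1 -> (J ^ m * size (lball_seq e r2) <= size (lball_seq e r1))%N.
Proof.
move=> e0 h.
rewrite -card_digits mulnC -(size_allpairs (fun w (f : {ffun 'I_m -> 'I_J}) => w *+ J + digits f)).
apply: uniq_leq_size.
  apply: allpairs_uniq; [exact: uniq_lball_seq|exact: enum_uniq|].
  move=> [z f] [w g] _ _ /= /rowP h1.
  have key i : z 0 i = w 0 i /\ f i = g i.
    have := h1 i; rewrite !mxE !mulmxnE !mulzn.
    have := ltn_ord (f i); have := ltn_ord (g i) => h2 h3 h4.
    suff : z 0 i = w 0 i /\ f i = g i :> nat by case=> -> /val_inj.
    exact: (radix_inj h3 h2 h4).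
  by congr (_, _); [apply/rowP => i|apply/ffunP => i]; case: (key i).
move=> z /allpairsP[[w f] [/= wG _ ->]]; rewrite mem_lball_seq // in wG; rewrite mem_lball_seq //.
rewrite lattD lattZ; apply: le_trans (nuD _ _) _.
apply: le_trans h; apply: lerD; last exact: nu_digits.
by rewrite nuZ normr_nat ler_wpM2l.
Qed.

(** Coordinatewise division by [J] sends the ball of radius r1 into that of radius r2, with J^m
    possible remainders; the extra term bounds the norm of a remainder. *)
Lemma size_lball_contract (e r1 r2 : R) (J : nat) : 0 < e -> (0 < J)%N ->
  r1 + e * J%:R * L <= J%:R * r2 -> (size (lball_seq e r1) <= J ^ m * size (lball_seq e r2))%N.
Proof.
move=> e0 J0 h.
rewrite -card_digits mulnC -(size_allpairs (fun w (f : {ffun 'I_m -> 'I_J}) => w *+ J + digits f)).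
apply: uniq_leq_size; first exact: uniq_lball_seq.
move=> z; rewrite mem_lball_seq // => zG.
case: J J0 h => // J _ h.
pose w : 'rV[int]_m := \row_i (z 0%R i %/ J.+1%:Z)%Z.
pose f : {ffun 'I_m -> 'I_J.+1} := [ffun i => inord (absz (z 0%R i %% J.+1%:Z)%Z)].
have zE : z = w *+ J.+1 + digits f.
  apply/rowP => i; rewrite !mxE mulmxnE !mxE ffunE inordK; last by lia.
  rewrite mulzn; lia.
apply/allpairsP; exists (w, f); split => //=; last by rewrite mem_enum.
rewrite mem_lball_seq // -(ler_pM2l (x := J.+1%:R)) ?ltr0n//.
rewrite -(normr_nat R) -nuZ -lattZ normr_nat.
have -> : w *+ J.+1 = z - digits f by rewrite zE addrK.
rewrite lattB; apply: le_trans (nuB _ _) _; apply: le_trans h.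
by apply: lerD => //; exact: nu_digits.
Qed.

Let L_ge0 : 0 <= L.
Proof. by apply: sumr_ge0. Qed.

(** With this mesh, rounding to the lattice costs at most 1/100, which fits into the slack of the
    radii 1/3, 1/8, 1/4, 101/100 and 5/4 used below. *)
Let e1 : R := (100 * (L + 1))^-1.

Let e1_gt0 : 0 < e1.
Proof. by rewrite invr_gt0 mulr_gt0// ltr_wpDl. Qed.

Let e1L : e1 * L <= 100^-1.
Proof.
rewrite /e1 invfM -mulrA ler_piMr ?invr_ge0// mulrC ler_pdivrMr ?ltr_wpDl//.
by rewrite mul1r lerDl.
Qed.

(** Subtracting from each lattice point of the unit ball a representative of its colour lands in the
    ball of radius 1/3, so the unit ball has at most [K] times as many points, and at least 2^m
    times as many by dilation. Colours replace centres because the latter may lie outside this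
    space. *)
Lemma norm_packing (K : nat) (col : 'rV[R]_m -> 'I_K) :
  (forall v w, nu v <= 1 -> nu w <= 1 -> col v = col w -> nu (v - w) <= 3^-1) ->
  (2 ^ m <= K)%N.
Proof.
move=> hcol.
have ball_gt0 : (0 < size (lball_seq e1 3^-1))%N.
  rewrite -has_predT; apply/hasP; exists 0 => //.
  by rewrite mem_lball_seq // /latt map_mx0 scaler0 nu0 invr_ge0.
rewrite -(leq_pmul2r ball_gt0); apply: (@leq_trans (size (lball_seq e1 1))).
  by apply: size_lball_dilate => //; have := e1L; lra.
pose rep (c : 'I_K) : 'rV[int]_m :=
  nth 0 (lball_seq e1 1) (find (fun z => col (latt e1 z) == c) (lball_seq e1 1)).
pose T := [seq p.1 + rep p.2 | p <- [seq (z, c) | z <- lball_seq e1 3^-1, c <- enum 'I_K]].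
have -> : (K * size (lball_seq e1 3^-1) = size T)%N.
  by rewrite size_map size_allpairs -cardE card_ord mulnC.
apply: uniq_leq_size => // z zG.
have hz : has (fun z' => col (latt e1 z') == col (latt e1 z)) (lball_seq e1 1).
  by apply/hasP; exists z.
have repG : rep (col (latt e1 z)) \in lball_seq e1 1 by apply: mem_nth; rewrite -has_find.
have repc : col (latt e1 (rep (col (latt e1 z)))) = col (latt e1 z).
  by apply/eqP; have := nth_find 0 hz.
apply/mapP; exists (z - rep (col (latt e1 z)), col (latt e1 z)); last by rewrite /= subrK.
apply/allpairsP; exists (z - rep (col (latt e1 z)), col (latt e1 z)); split => //=; last by rewrite mem_enum.
by rewrite mem_lball_seq // lattB; apply: hcol; rewrite ?repc // -mem_lball_seq.
Qed.

Let separated (s : seq 'rV[int]_m) :=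
  pairwise (fun z w => 4^-1 < nu (latt e1 z - latt e1 w)) s.

(** Balls of radius 1/8 about 1/4-separated points are disjoint and lie in the ball of radius 5/4,
    which has at most 16^m times as many lattice points as one of them. *)
Let size_separated s : separated s -> {subset s <= lball_seq e1 (101/100)} ->
  (size s <= 16 ^ m)%N.
Proof.
move=> sep sG.
have ball_gt0 : (0 < size (lball_seq e1 (1/8)))%N.
  rewrite -has_predT; apply/hasP; exists 0 => //.
  by rewrite mem_lball_seq // /latt map_mx0 scaler0 nu0 divr_ge0.
rewrite -(leq_pmul2r ball_gt0); apply: (@leq_trans (size (lball_seq e1 (5/4)))); last first.
  by apply: size_lball_contract => //; have := e1L; lra.
rewrite -(size_allpairs (fun z w => z + w)); apply: uniq_leq_size; last first.
  move=> z /allpairsP[[w f] [/= /sG wG fG ->]]; rewrite !mem_lball_seq // in wG fG *.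
  by rewrite lattD; apply: le_trans (nuD _ _) _; lra.
elim: s sep sG => //= z s IH /andP[zs sep] sG.
rewrite cat_uniq map_inj_uniq; last exact: addrI.
rewrite uniq_lball_seq IH ?andbT//=; last by move=> w ws; apply: sG; rewrite inE ws orbT.
apply/negP => /hasP[y /allpairsP[[w f] [/= ws fG ->]]] /mapP[g gG] h.
have := allP zs _ ws; rewrite ltNge => /negP; apply.
have -> : latt e1 z - latt e1 w = latt e1 f - latt e1 g.
  by apply/eqP; rewrite subr_eq addrAC eq_sym subr_eq -!lattD addrC h addrC.
by rewrite !mem_lball_seq // in fG gG; apply: le_trans (nuB _ _) _; lra.
Qed.

Let max_separated : exists2 s, separated s /\ {subset s <= lball_seq e1 (101/100)} &
  forall z, z \in lball_seq e1 (101/100) -> has (fun w => nu (latt e1 z - latt e1 w) <= 4^-1) s.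
Proof.
suff : forall (l : seq 'rV[int]_m), exists2 s, separated s /\ {subset s <= l} &
    forall z, z \in l -> has (fun w => nu (latt e1 z - latt e1 w) <= 4^-1) s.
  exact.
elim=> [|z l [s [sep sl] cov]]; first by exists [::].
have [hz|hz] := boolP (has (fun w => nu (latt e1 z - latt e1 w) <= 4^-1) s).
  exists s; first by split=> // w /sl; rewrite inE => ->; rewrite orbT.
  by move=> w; rewrite inE => /predU1P[->//|/cov].
exists (z :: s).
  split.
    rewrite /separated /= [pairwise _ _]sep andbT; apply/allP => w ws.
    by rewrite ltNge; apply: contra hz => h; apply/hasP; exists w.
  by move=> w; rewrite !inE => /predU1P[->|/sl ->]; rewrite ?eqxx ?orbT.
move=> w; rewrite inE => /predU1P[->|/cov h] /=; last by rewrite h orbT.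
by rewrite subrr nu0 invr_ge0 ler0n.
Qed.

(** The centres form a maximal 1/4-separated set of lattice points. A vector is first rounded down
    to the lattice, which may push it out to radius 101/100, so the distance to a centre is at most
    1/100 + 1/4. *)
Lemma norm_covering : exists2 ys : seq 'rV[R]_m, (size ys <= 16 ^ m)%N &
  forall v, nu v <= 1 -> exists2 y, y \in ys & nu (v - y) <= 2^-1.
Proof.
have [s [sep sG] cov] := max_separated.
exists (map (latt e1) s); first by rewrite size_map; exact: size_separated.
move=> v v1.
pose z : 'rV[int]_m := \row_i Num.floor (v 0 i / e1).
have vz : nu (v - latt e1 z) <= 100^-1.
  apply: le_trans e1L; apply: nu_sup => i; rewrite !mxE.
  have /andP[h1 h2] := Num.Theory.floor_itv (v 0 i / e1).
  rewrite ler_pdivlMr// mulrC in h1; rewrite ltr_pdivrMr// mulrC intrD mulrDr in h2.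
  by rewrite ger0_norm ?subr_ge0// lerBlDl; lra.
have zG : z \in lball_seq e1 (101/100).
  rewrite mem_lball_seq //; have -> : latt e1 z = v - (v - latt e1 z) by rewrite opprB addrC subrK.
  by apply: le_trans (nuB _ _) _; lra.
have /hasP[w ws h] := cov _ zG.
exists (latt e1 w); first exact: map_f.
have -> : v - latt e1 w = (v - latt e1 z) + (latt e1 z - latt e1 w) by rewrite addrA subrK.
by apply: le_trans (nuD _ _) _; lra.
Qed.

(** The error after [j] steps, multiplied by 2^j, is again in the unit ball and is covered once
    more. *)
Lemma norm_covering_pow (j : nat) : exists2 ys : seq 'rV[R]_m, (size ys <= 16 ^ (m * j))%N &
  forall v, nu v <= 1 -> exists2 y, y \in ys & nu (v - y) <= 2^-1 ^+ j.
Proof.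
have [zs zsize zcov] := norm_covering.
elim: j => [|j [ys ysize ycov]].
  by exists [:: 0] => [|v v1]; rewrite ?muln0//; exists 0; rewrite ?inE// subr0 expr0.
exists [seq y + 2^-1 ^+ j *: z | y <- ys, z <- zs].
  by rewrite size_allpairs mulnS addnC expnD leq_mul.
move=> v /ycov[y yys vy].
have [z zzs hz] : exists2 z, z \in zs & nu (2 ^+ j *: (v - y) - z) <= 2^-1.
  apply: zcov; rewrite nuZ ger0_norm ?exprn_ge0// -(@ler_pM2l _ (2^-1 ^+ j)) ?exprn_gt0//.
  by rewrite mulrA -exprMn mulVf// expr1n mul1r mulr1.
exists (y + 2^-1 ^+ j *: z); first exact: allpairs_f.
have -> : v - (y + 2^-1 ^+ j *: z) = 2^-1 ^+ j *: (2 ^+ j *: (v - y) - z).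
  by rewrite scalerBr scalerA -exprMn mulVf// expr1n scale1r opprD addrA.
by rewrite nuZ ger0_norm ?exprn_ge0// exprSr ler_wpM2l// exprn_ge0.
Qed.

End LatticeCount.

(** * Coverings in L_q by balls of trigonometric polynomials *)

Section Covers.
Variables (R : realType) (d : nat) (q : \bar R).
Hypothesis q1 : (1 <= q)%E.
Local Notation T := (d.-tuple R).
Local Notation mu := (torus_measure R d).
Implicit Types (f g : T -> R[i]) (ks : seq {ffun 'I_d -> int}).
Local Notation Re := complex.Re.
Local Notation Im := complex.Im.
Local Notation normc := Normc.normc.

Lemma dot_shift (k : {ffun 'I_d -> int}) (j : 'I_d) (h : R) (x : T) :
  dot k (shift_coord j h x) = dot k x + (k j)%:~R * h.
Proof.
rewrite /dot (bigD1 j)//= [in RHS](bigD1 j)//= tnth_mktuple eqxx mulrDr -!addrA.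
congr (_ + _); rewrite [RHS]addrC; congr (_ + _).
by apply: eq_bigr => i /negPf ij; rewrite tnth_mktuple ij.
Qed.

Lemma tpoly_Lp ks c : Lp q (tpoly ks c : T -> R[i]).
Proof.
split; last 2 first.
- exact: cmeasurable_tpoly.
- apply: (@le_lt_trans _ _ (\sum_(k <- ks) normc (c k))%:E); last by rewrite ltry.
  apply: normLp_le_sup => //; first by apply: sumr_ge0 => k _; exact: normc_ge0.
    exact: cmeasurable_tpoly.
  move=> x; rewrite /tpoly; elim/big_ind2 : _ => [|y1 z1 y2 z2 h1 h2|k _].
  + by rewrite Normc.normc0.
  + by apply: (le_trans (@le_normcD R z1 z2)); exact: lerD.
  + by rewrite Normc.normcM normc_cexpi mulr1.
- move=> j x; rewrite /tpoly; apply: eq_bigr => k _.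
  by rewrite dot_shift cexpi_periodic.
Qed.

Lemma Lp_add f g : Lp q f -> Lp q g -> Lp q (f + g).
Proof.
move=> [pf mf fy] [pg mg gy]; split; last 2 first.
- exact: cmeasurableD.
- by apply: le_lt_trans (normLpD q1 mf mg) _; rewrite lte_add_pinfty.
- by move=> j x; rewrite !fctE pf pg.
Qed.

Lemma Lp_scale f (a : R) : Lp q f -> Lp q (fun x => (a%:C)%C * f x).
Proof.
move=> [pf mf fy]; split; last 2 first.
- by apply: cmeasurableM => //; exact: cmeasurable_cst.
- by rewrite normLpZ// lte_mul_pinfty.
- by move=> j x; rewrite pf.
Qed.

(** Centres form a sequence of which the first [K] count, so that pairs of indices can be coded by
    division with remainder in [covered_add]. *)
Definition covered (A : set (T -> R[i])) (r : R) (K : nat) :=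
  exists y : nat -> T -> R[i], (forall j, Lp q (y j)) /\
    forall f, A f -> exists2 j, (j < K)%N & (normLp q (f - y j)%R <= r%:E)%E.

Lemma covered_entropy A r k : (forall f, A f -> Lp q f) -> covered A r (2 ^ k) ->
  (entropy_Lp q A k <= r%:E)%E.
Proof.
move=> AL [y [yL cov]]; apply: ereal_inf_lbound; exists r => //.
exists (fun j => y j); split=> [j|f Af]; first exact: yL.
have [j jk h] := cov f Af.
by exists (Ordinal jk) => //; split=> //; exact: AL.
Qed.

Lemma covered_leq A r K K' : (K <= K')%N -> covered A r K -> covered A r K'.
Proof.
move=> KK' [y [yL cov]]; exists y; split=> // f /cov[j jK h].
by exists j => //; exact: leq_trans KK'.
Qed.

Lemma covered_add (A B C : set (T -> R[i])) r s K L :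
  (forall f, C f -> exists2 g, A g & exists2 h, B h & f = g + h) ->
  (forall f, A f -> Lp q f) -> (forall f, B f -> Lp q f) ->
  covered A r K -> covered B s L -> covered C (r + s) (K * L).
Proof.
move=> Csub AL BL [y [yL ycov]] [z [zL zcov]].
exists (fun n => y (n %/ L)%N + z (n %% L)%N); split=> [j|f /Csub[g Ag [h Bh ->]]].
  exact: Lp_add.
have [i iK hi] := ycov g Ag; have [j jL hj] := zcov h Bh.
exists (i * L + j)%N.
  have : (i.+1 * L <= K * L)%N by rewrite leq_mul2r iK orbT.
  by rewrite mulSn; lia.
have L0 : (0 < L)%N by apply: leq_ltn_trans jL.
rewrite divnMDl// divn_small// addn0 modnMDl modn_small//.
have -> : g + h - (y i + z j) = (g - y i) + (h - z j) by rewrite opprD addrACA.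
have [_ mg _] := AL g Ag; have [_ mh _] := BL h Bh.
have [_ my _] := yL i; have [_ mz _] := zL j.
apply: le_trans (normLpD q1 _ _) _; [exact: cmeasurableB|exact: cmeasurableB|].
by rewrite EFinD; exact: leeD.
Qed.

Lemma covered_zero (A : set (T -> R[i])) r : (forall f, A f -> (normLp q f <= r%:E)%E) ->
  covered A r 1.
Proof.
move=> Ar; exists (fun=> 0); split=> [j|f Af].
  by have := tpoly_Lp [::] (fun=> 0); congr Lp; apply/funext => x; rewrite /tpoly big_nil.
by exists 0%N => //; rewrite subr0; exact: Ar.
Qed.

Definition tball ks (r : R) : set (T -> R[i]) :=
  [set f | (exists c, f = tpoly ks c) /\ (normLp q f <= r%:E)%E].

Section Coordinates.
Variable ks : seq {ffun 'I_d -> int}.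
Hypothesis uks : uniq ks.
Local Notation N := (size ks).

(** Entries are read at natural numbers, with default 0, to avoid ordinal casts: positions below [N]
    hold real parts of coefficients, the next [N] imaginary parts. *)
Let entry (v : 'rV[R]_(N + N)) (n : nat) : R := if insub n is Some i then v 0 i else 0.

Let entryE v (i : 'I_(N + N)) : entry v i = v 0 i.
Proof. by rewrite /entry valK. Qed.

Let entryD v w n : entry (v + w) n = entry v n + entry w n.
Proof. by rewrite /entry; case: insubP => [i _ _|_]; rewrite ?mxE ?addr0. Qed.

Let entryZ a v n : entry (a *: v) n = a * entry v n.
Proof. by rewrite /entry; case: insubP => [i _ _|_]; rewrite ?mxE ?mulr0. Qed.

Let cf (v : 'rV[R]_(N + N)) (k : {ffun 'I_d -> int}) : R[i] :=
  (entry v (index k ks) +i* entry v (N + index k ks))%C.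

Let P (v : 'rV[R]_(N + N)) : T -> R[i] := tpoly ks (cf v).

Let PD v w : P (v + w) = P v + P w.
Proof.
apply/funext => x; rewrite fctE /P /tpoly -big_split; apply: eq_bigr => k _ /=.
by rewrite -mulrDl /cf !entryD.
Qed.

Let PZ a v : P (a *: v) = (fun x => (a%:C)%C * P v x).
Proof.
apply/funext => x; rewrite /P /tpoly mulr_sumr; apply: eq_bigr => k _ /=.
rewrite mulrA /cf !entryZ; congr (_ * _); apply/eqP; rewrite eq_complex /=.
by rewrite !mul0r subr0 addr0 !eqxx.
Qed.

Let P_surj c : exists v, P v = tpoly ks c.
Proof.
pose k0 : {ffun 'I_d -> int} := [ffun=> 0].
exists (\row_(i < N + N) if (i < N)%N then Re (c (nth k0 ks i)) else Im (c (nth k0 ks (i - N)))).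
apply/funext => x; rewrite /P /tpoly; apply: eq_big_seq => k kks; congr (_ * _).
have ik : (index k ks < N)%N by rewrite index_mem.
rewrite /cf /entry insubT; first by lia.
move=> h1; rewrite insubT; first by lia.
move=> h2; rewrite !mxE /= ik nth_index// ltnNge leq_addr /= addKn nth_index//.
by case: (c k).
Qed.

Let nu v := fine (normLp q (P v)).

Let nuE v : normLp q (P v) = (nu v)%:E.
Proof.
by have [_ _ h] := tpoly_Lp ks (cf v); rewrite /nu fineK// ge0_fin_numE// normLp_ge0.
Qed.

Let nuD (v w : 'rV[R]_(N + N)) : nu (v + w) <= nu v + nu w.
Proof.
by rewrite -lee_fin EFinD -!nuE PD; apply: normLpD => //; exact: cmeasurable_tpoly.
Qed.

Let nuZ (a : R) (v : 'rV[R]_(N + N)) : nu (a *: v) = `|a| * nu v.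
Proof.
by apply: EFin_inj; rewrite EFinM -!nuE PZ normLpZ//; exact: cmeasurable_tpoly.
Qed.

Let nu_coord (v : 'rV[R]_(N + N)) i : `|v 0 i| <= nu v.
Proof.
pose k0 : {ffun 'I_d -> int} := [ffun=> 0].
have [_ mP yP] := tpoly_Lp ks (cf v).
have h n : (n < N)%N -> `|entry v n| <= nu v /\ `|entry v (N + n)| <= nu v.
  move=> nN; rewrite -!lee_fin -nuE.
  have := fourier_coef_norm_le (nth k0 ks n) q1 mP yP.
  by rewrite fourier_coef_tpoly// mem_nth//= index_uniq.
rewrite -entryE; have [iN|iN] := ltnP i N; first by have [] := h _ iN.
have := ltn_ord i => iNN.
have [|_] := h (i - N)%N; first by lia.
by rewrite subnKC.
Qed.

Lemma tball_covered (r : R) (j : nat) : 0 < r ->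
  covered (tball ks r) (r * 2^-1 ^+ j) (16 ^ ((N + N) * j)).
Proof.
move=> r0; have [ys ysize cov] := norm_covering_pow nuD nuZ nu_coord j.
exists (fun n x => (r%:C)%C * P (nth 0 ys n) x); split=> [n|f [[c ->] fr]].
  by apply: Lp_scale; exact: tpoly_Lp.
have [v vc] := P_surj c.
have v1 : nu (r^-1 *: v) <= 1.
  by rewrite nuZ gtr0_norm ?invr_gt0// mulrC ler_pdivrMr// mul1r -lee_fin -nuE vc.
have [y yys hy] := cov _ v1.
exists (index y ys); first by rewrite (leq_trans _ ysize)// index_mem.
rewrite nth_index//.
have -> : tpoly ks c - (fun x => (r%:C)%C * P y x) = (fun x => (r%:C)%C * P (r^-1 *: v - y) x).
  have -> : r^-1 *: v - y = r^-1 *: v + (-1) *: y by rewrite scaleN1r.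
  apply/funext => x; rewrite PD !PZ -vc fctE; apply/esym.
  rewrite fctE mulrDr !mulrA -!rmorphM /= divff ?gt_eqF// rmorph1 mul1r.
  by rewrite mulrN1 rmorphN mulNr.
rewrite normLpZ//; last exact: cmeasurable_tpoly.
by rewrite nuE -EFinM lee_fin gtr0_norm// ler_pM2l.
Qed.

(** Were A covered with radius e < r/6, two points of one covering ball would be at distance at most
    2e < r/3; colouring by the covering ball then contradicts [norm_packing] in real dimension 2N >
    k. *)
Lemma tball_entropy_ge (A : set (T -> R[i])) (r : R) (k : nat) : 0 < r ->
  tball ks r `<=` A -> (k < N + N)%N -> ((r / 6)%:E <= entropy_Lp q A k)%E.
Proof.
move=> r0 subA kN; apply: le_ereal_inf_tmp => _ [e [y [yL cov]] <-].
rewrite lee_fin leNgt; apply/negP => er.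
have K0 : (0 < 2 ^ k)%N by rewrite expn_gt0.
have ball v : nu v <= 1 -> exists j : 'I_(2 ^ k), (normLp q (P (r *: v) - y j)%R <= e%:E)%E.
  move=> v1; have [|j _ [_ h]] := cov (P (r *: v)); last by exists j.
  apply: subA; split; first by exists (cf (r *: v)).
  by rewrite nuE lee_fin nuZ gtr0_norm// ler_piMr// ltW.
(* [Ordinal K0] is a default colour outside the unit ball, where [norm_packing] asks nothing. *)
pose col v : 'I_(2 ^ k) := if pselect (nu v <= 1) is left h then sval (cid (ball v h)) else Ordinal K0.
have colP v : nu v <= 1 -> (normLp q (P (r *: v) - y (col v))%R <= e%:E)%E.
  by move=> v1; rewrite /col; case: pselect => // h; case: cid.
have : (2 ^ (N + N) <= 2 ^ k)%N.
  apply: (norm_packing nuD nuZ nu_coord (col := col)) => v w v1 w1 vw.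
  have hv := colP v v1; have hw := colP w w1; rewrite -vw in hw.
  have [_ my _] := yL (col v).
  have mP u : cmeasurable (P u) by exact: cmeasurable_tpoly.
  have : (normLp q (P (r *: (v - w))) <= (e + e)%:E)%E.
    have -> : P (r *: (v - w)) = (P (r *: v) - y (col v)) - (P (r *: w) - y (col v)).
      rewrite opprB addrA subrK; have -> : r *: (v - w) = r *: v + (-1) *: (r *: w).
        by rewrite scaleN1r scalerBr.
      rewrite PD; congr (_ + _); rewrite [P (-1 *: _)]PZ; apply/funext => x.
      by rewrite fctE rmorphN1 mulN1r.
    apply: le_trans (normLpB q1 _ _) _; [exact: cmeasurableB|exact: cmeasurableB|].
    by rewrite EFinD; exact: leeD.
  rewrite nuE lee_fin nuZ gtr0_norm// => h.
  rewrite -(ler_pM2l r0); apply: le_trans h _; lra.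
by rewrite leq_exp2l// leqNgt kN.
Qed.

End Coordinates.

Lemma covered_partial_sums (K : nat -> seq {ffun 'I_d -> int}) (w : nat -> R) (e : nat -> nat) (M : nat) :
  (forall n, uniq (K n)) -> (forall n, 0 < w n) ->
  covered [set f | exists t : nat -> T -> R[i], (forall n, tball (K n) (w n) (t n)) /\
    f = \sum_(n < M) t n]
    (\sum_(n < M) w n * 2^-1 ^+ e n)
    (16 ^ (\sum_(n < M) (size (K n) + size (K n)) * e n)).
Proof.
move=> uK w0; elim: M => [|M IH].
  rewrite !big_ord0 expn0; apply: covered_zero => f [t [_ ->]].
  by rewrite big_ord0 normLp0.
rewrite !big_ord_recr /= expnD.
apply: covered_add IH (tball_covered (uK M) (e M) (w0 M)).
- move=> f [t [tb ->]]; exists (\sum_(n < M) t n); first by exists t.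
  by exists (t M) => //; rewrite big_ord_recr.
- move=> f [t [tb ->]]; elim: (M) => [|m IHm].
    rewrite big_ord0; have := tpoly_Lp [::] (fun=> 0); congr Lp.
    by apply/funext => x; rewrite /tpoly big_nil.
  rewrite big_ord_recr; apply: Lp_add => //.
  by have [[c ->] _] := tb m; exact: tpoly_Lp.
- by move=> f [[c ->] _]; exact: tpoly_Lp.
Qed.

Lemma covered_sums (A : set (T -> R[i])) (K : nat -> seq {ffun 'I_d -> int}) (w : nat -> R)
    (e : nat -> nat) (M : nat) (tail : R) :
  (forall n, uniq (K n)) -> (forall n, 0 < w n) -> (forall f, A f -> Lp q f) ->
  (forall f, A f -> exists t : nat -> T -> R[i], (forall n, tball (K n) (w n) (t n)) /\
    (normLp q (f - \sum_(n < M) t n)%R <= tail%:E)%E) ->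
  covered A (\sum_(n < M) w n * 2^-1 ^+ e n + tail)
    (16 ^ (\sum_(n < M) (size (K n) + size (K n)) * e n)).
Proof.
move=> uK w0 AL At; have [y [yL cov]] := covered_partial_sums e M uK w0.
exists y; split=> // f Af; have [t [tb ht]] := At f Af.
have [|j jK hj] := cov (\sum_(n < M) t n); first by exists t.
exists j => //.
have -> : f - y j = (\sum_(n < M) t n - y j) + (f - \sum_(n < M) t n).
  by rewrite [RHS]addrC addrA subrK.
have mS m : cmeasurable (\sum_(n < m) t n).
  elim: m => [|m IHm]; first by rewrite big_ord0; exact: cmeasurable_cst.
  rewrite big_ord_recr; apply: cmeasurableD => //.
  by have [[c ->] _] := tb m; exact: cmeasurable_tpoly.
have [_ mf _] := AL f Af; have [_ my _] := yL j.
apply: le_trans (normLpD q1 _ _) _; [exact: cmeasurableB|exact: cmeasurableB|].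
by rewrite EFinD; exact: leeD.
Qed.

End Covers.

(** * Asymptotics of the layer weights *)

Section PowerComparison.
Variable R : realType.
Implicit Types (x y c g : R).

(** The sign of the exponent is unknown, as that of b is, so both comparisons are assumed and the
    constant carries |g|. *)
Lemma powR_comparable x y c g : 0 < x -> 0 < y -> 1 <= c -> x <= c * y -> y <= c * x ->
  x `^ g <= c `^ `|g| * y `^ g.
Proof.
move=> x0 y0 c1 xy yx; have c0 : 0 < c by apply: lt_le_trans c1.
have [g0|g0] := leP 0 g.
  rewrite ger0_norm// -powRM; [|exact: ltW|exact: ltW].
  by apply: ge0_ler_powR; rewrite ?nnegrE ?mulr_ge0// ltW.
rewrite ltr0_norm//.
have xg : 0 < x `^ (- g) by rewrite powR_gt0.
have yg : 0 < y `^ (- g) by rewrite powR_gt0.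
have : y `^ (- g) <= c `^ (- g) * x `^ (- g).
  rewrite -powRM; [|exact: ltW|exact: ltW].
  by apply: ge0_ler_powR; rewrite ?nnegrE ?mulr_ge0 ?oppr_ge0// ltW.
have e (z : R) : z `^ g = (z `^ (- g))^-1 by rewrite -powRN opprK.
rewrite !e => h.
by rewrite ler_pdivlMr// mulrC ler_pdivrMr.
Qed.

Lemma powR2_gt0 x : 0 < 2 `^ x :> R.
Proof. by rewrite powR_gt0. Qed.

Lemma powR2D x y : 2 `^ (x + y) = 2 `^ x * 2 `^ y :> R.
Proof. by rewrite powRD// pnatr_eq0 implybT. Qed.

End PowerComparison.

Section Weights.
Variables (R : realType) (a b : R).

(* The weight with n + 1 in place of max(n, 1): it changes by a bounded factor
   when n is shifted by a constant. *)
Definition psi (n : nat) : R := 2 `^ (- (a * n%:R)) * n.+1%:R `^ b.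

Definition weight (n : nat) : R := 2 `^ (- (a * n%:R)) * (maxn n 1)%:R `^ b.

Lemma psi_gt0 n : 0 < psi n.
Proof. by rewrite mulr_gt0 ?powR_gt0. Qed.

Lemma weight_gt0 n : 0 < weight n.
Proof. by rewrite mulr_gt0 ?powR_gt0// ltr0n leq_max orbT. Qed.

Let max1_comparable n : (maxn n 1)%:R <= 2 * n.+1%:R :> R /\ n.+1%:R <= 2 * (maxn n 1)%:R :> R.
Proof. by rewrite -!natrM !ler_nat; lia. Qed.

Let c2 : 0 < (2 : R) `^ `|b|. Proof. exact: powR2_gt0. Qed.

Lemma weight_le_psi n : weight n <= 2 `^ `|b| * psi n.
Proof.
have [h1 h2] := max1_comparable n.
rewrite /weight /psi mulrCA ler_pM2l ?powR2_gt0//.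
by apply: powR_comparable => //; rewrite ?ltr0n ?leq_max ?orbT// ler1n.
Qed.

Lemma psi_le_weight n : psi n <= 2 `^ `|b| * weight n.
Proof.
have [h1 h2] := max1_comparable n.
rewrite /weight /psi mulrCA ler_pM2l ?powR2_gt0//.
by apply: powR_comparable => //; rewrite ?ltr0n ?leq_max ?orbT// ler1n.
Qed.

(** The ratio of m + 1 and n + 1, in either order, is at most |m - n| + 1. *)
Let comp (m n : nat) : n.+1%:R `^ b <= ((maxn m n - minn m n).+1%:R : R) `^ `|b| * m.+1%:R `^ b.
Proof. by apply: powR_comparable; rewrite ?ltr0n ?ler1n// -natrM ler_nat; nia. Qed.

Lemma psi_le_left m n : (n <= m)%N ->
  psi n <= 2 `^ (a * (m - n)%:R) * (m - n).+1%:R `^ `|b| * psi m.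
Proof.
move=> nm; have := comp m n; rewrite (maxn_idPl nm) (minn_idPr nm) => h.
have -> : 2 `^ (a * (m - n)%:R) * (m - n).+1%:R `^ `|b| * psi m =
    2 `^ (- (a * n%:R)) * ((m - n).+1%:R `^ `|b| * m.+1%:R `^ b) :> R.
  rewrite /psi; have -> : - (a * n%:R) = a * (m - n)%:R + (- (a * m%:R)).
    by rewrite natrB//; ring.
  by rewrite powR2D; ring.
by rewrite ler_pM2l ?powR2_gt0.
Qed.

Lemma psi_le_right m n : (m <= n)%N ->
  psi n <= 2 `^ (- (a * (n - m)%:R)) * (n - m).+1%:R `^ `|b| * psi m.
Proof.
move=> mn; have := comp m n; rewrite (maxn_idPr mn) (minn_idPl mn) => h.
have -> : 2 `^ (- (a * (n - m)%:R)) * (n - m).+1%:R `^ `|b| * psi m =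
    2 `^ (- (a * n%:R)) * ((n - m).+1%:R `^ `|b| * m.+1%:R `^ b) :> R.
  rewrite /psi; have -> : - (a * n%:R) = - (a * (n - m)%:R) + (- (a * m%:R)).
    by rewrite natrB//; ring.
  by rewrite powR2D; ring.
by rewrite ler_pM2l ?powR2_gt0.
Qed.

Definition decay (s : R) (i : nat) : R := 2 `^ (- (s * i%:R)) * i.+1%:R `^ `|b|.

Let decay_ge0 s i : 0 <= decay s i.
Proof. by rewrite mulr_ge0 ?powR_ge0. Qed.

Lemma decay_summable s : 0 < s -> exists2 C : R, 0 < C & forall n, \sum_(i < n) decay s i <= C.
Proof.
move=> s0; pose g := `|b|.
have ln2 : 0 < ln 2 :> R by rewrite ln_gt0// ltr1n.
(* From i + 1 <= e^(t i) / t, valid for t <= 1, the polynomial factor is at most a constant times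
   e^(g t i). This [t] makes that growth consume at most half of the decay 2^(-s i), leaving a
   geometric series of ratio [z]. *)
pose t : R := Num.min 1 (s * ln 2 / (2 * (g + 1))).
have g0 : 0 <= g by rewrite /g.
have den0 : 0 < 2 * (g + 1) by lra.
have t0 : 0 < t by rewrite lt_min ltr01 divr_gt0// mulr_gt0.
have t1 : t <= 1 by rewrite ge_min lexx.
have tg : g * t <= s * ln 2 / 2.
  apply: (@le_trans _ _ ((g + 1) * t)); first by rewrite ler_pM2r//; lra.
  have : t <= s * ln 2 / (2 * (g + 1)) by rewrite ge_min lexx orbT.
  rewrite ler_pdivlMr// => h; rewrite ler_pdivlMr//; apply: le_trans h.
  by rewrite le_eqVlt; apply/orP; left; apply/eqP; ring.
pose z : R := expR (- (s * ln 2 / 2)).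
have z1 : z < 1 by rewrite expR_lt1 oppr_lt0 divr_gt0// mulr_gt0.
have z0 : 0 < z by exact: expR_gt0.
have poly i : i.+1%:R `^ g <= t^-1 `^ g * expR (g * t * i%:R).
  have : i.+1%:R <= t^-1 * expR (t * i%:R).
    rewrite mulrC ler_pdivlMr//; apply: le_trans (expR_ge1Dx _).
    by rewrite -natr1 mulrDl mul1r addrC mulrC lerD2r.
  move=> h; have h' : (t^-1 * expR (t * i%:R)) `^ g = t^-1 `^ g * expR (g * t * i%:R).
    rewrite powRM ?invr_ge0 ?expR_ge0 ?ltW//; congr (_ * _).
    by rewrite /powR gt_eqF ?expR_gt0// expRK mulrA.
  rewrite -h'; apply: ge0_ler_powR; rewrite ?nnegrE//.
  by rewrite mulr_ge0 ?invr_ge0 ?expR_ge0 ?ltW.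
have bound i : decay s i <= t^-1 `^ g * z ^+ i.
  rewrite /decay; apply: le_trans (ler_wpM2l (powR_ge0 _ _) (poly i)) _.
  rewrite mulrCA ler_pM2l ?powR_gt0 ?invr_gt0//.
  rewrite /z -expRM_natl {1}/powR pnatr_eq0 /= -expRD ler_expR.
  have := ler_wpM2r (ler0n R i) tg; lra.
exists (t^-1 `^ g * (1 - z)^-1); first by rewrite mulr_gt0 ?powR_gt0 ?invr_gt0// subr_gt0.
move=> n; apply: (@le_trans _ _ (t^-1 `^ g * \sum_(i < n) z ^+ i)).
  by rewrite mulr_sumr; apply: ler_sum.
rewrite ler_wpM2l ?powR_ge0// -[leRHS]mul1r ler_pdivlMr ?subr_gt0//.
have := subrX1 z n => e.
have -> : (\sum_(i < n) z ^+ i) * (1 - z) = 1 - z ^+ n by rewrite -[1 - z ^+ n]opprB e; ring.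
by rewrite lerBlDr lerDl exprn_ge0 ?ltW.
Qed.

Hypothesis a0 : 0 < a.

Lemma psi_sub (h : nat) : exists2 C : R, 0 < C & forall m, psi (m - h) <= C * psi m.
Proof.
exists (2 `^ (a * h%:R) * h.+1%:R `^ `|b|); first by rewrite mulr_gt0 ?powR_gt0.
move=> m; apply: le_trans (psi_le_left (leq_subr h m)) _.
rewrite ler_pM2r ?psi_gt0// ler_pM ?powR_ge0//.
  rewrite ler_powR ?ler1n// ler_pM2l// ler_nat; lia.
by rewrite ge0_ler_powR// ?nnegrE// ler_nat; lia.
Qed.

Lemma psi_add (h : nat) : exists2 C : R, 0 < C & forall m, psi m <= C * psi (m + h).
Proof.
exists (2 `^ (a * h%:R) * h.+1%:R `^ `|b|); first by rewrite mulr_gt0 ?powR_gt0.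
by move=> m; have := psi_le_left (leq_addr h m); rewrite addKn.
Qed.

Lemma weight_tail : exists2 C : R, 0 < C &
  forall m n, \sum_(m <= l < m + n) weight l <= C * psi m.
Proof.
have [D D0 hD] := decay_summable a0.
exists (2 `^ `|b| * D); first by rewrite mulr_gt0.
move=> m n; rewrite -{1}[m]add0n big_addn addKn big_mkord.
apply: (@le_trans _ _ (\sum_(i < n) 2 `^ `|b| * (decay a i * psi m))).
  apply: ler_sum => i _; apply: le_trans (weight_le_psi _) _.
  rewrite ler_pM2l//; have := psi_le_right (leq_addl i m).
  by rewrite addnK.
rewrite -mulr_sumr -mulr_suml -mulrA ler_pM2l//.
by rewrite ler_pM2r ?psi_gt0.
Qed.

(** Going back from [m] to [n], the weight grows by 2^(a(m-n)) up to a power of m - n + 1, while the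
    refinement gains 2^(-J(m-n)); the margin 1 in J >= a + 1 leaves the summable [decay 1]. *)
Lemma weight_head (J : nat) : a + 1 <= J%:R -> exists2 C : R, 0 < C &
  forall m, \sum_(n < m.+1) weight n * 2^-1 ^+ (J * (m - n)) <= C * psi m.
Proof.
move=> aJ; have [D D0 hD] := decay_summable (@ltr01 R).
exists (2 `^ `|b| * D); first by rewrite mulr_gt0.
move=> m.
apply: (@le_trans _ _ (\sum_(n < m.+1) 2 `^ `|b| * (decay 1 (m - n) * psi m))).
  apply: ler_sum => n _; have nm : (n <= m)%N by rewrite -ltnS.
  apply: (@le_trans _ _ (2 `^ `|b| * (2 `^ (a * (m - n)%:R) * (m - n).+1%:R `^ `|b| * psi m)
      * 2^-1 ^+ (J * (m - n)))).
    rewrite ler_wpM2r ?exprn_ge0//; apply: le_trans (weight_le_psi _) _.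
    by rewrite ler_pM2l//; exact: psi_le_left.
  set X := (m - n).+1%:R `^ _; set Y := psi m; set U := 2 `^ (a * _); set V := _ ^+ _.
  have -> : 2 `^ `|b| * (U * X * Y) * V = 2 `^ `|b| * (U * V * (X * Y)) by ring.
  rewrite ler_pM2l// /decay -/X -mulrA {}/U {}/V.
  have -> : 2^-1 ^+ (J * (m - n)) = 2 `^ (- (J%:R * (m - n)%:R)) :> R.
    by rewrite exprVn powRN -natrM powR_mulrn.
  have h : 2 `^ (a * (m - n)%:R) * 2 `^ (- (J%:R * (m - n)%:R)) <= 2 `^ (- (1 * (m - n)%:R)) :> R.
    rewrite -powR2D ler_powR ?ler1n// -mulrBl -mulNr ler_wpM2r//; lra.
  have XY : 0 <= X * Y by rewrite mulr_ge0 ?powR_ge0// ltW ?psi_gt0.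
  by rewrite mulrA -[leRHS]mulrA; exact: ler_wpM2r.
rewrite -mulr_sumr -mulr_suml -mulrA ler_pM2l// ler_pM2r ?psi_gt0//.
rewrite (reindex_inj rev_ord_inj) /= (eq_bigr (fun i : 'I_m.+1 => decay 1 i)); first exact: hD.
by move=> i _; rewrite subSS subKn// -ltnS.
Qed.

End Weights.

(** * From the layer index to k and log k *)

Section LogarithmicScale.
Variables (R : realType) (d' : nat) (a b : R).

Definition scale (m : nat) : nat := (2 ^ m * m.+1 ^ d')%N.

Lemma scale_bracket k : (0 < k)%N -> exists m, (scale m <= k < scale m.+1)%N.
Proof.
move=> k0.
have ex0 : exists m, (scale m <= k)%N by exists 0%N; rewrite /scale expn0 exp1n.
have ub m : (scale m <= k)%N -> (m <= k)%N.
  move=> h; apply: leq_trans h; rewrite /scale.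
  by apply: leq_trans (ltnW (ltn_expl m (isT : 1 < 2)%N)) _; rewrite leq_pmulr// expn_gt0.
have [m hm hmax] := ex_maxnP ex0 ub.
exists m; rewrite hm ltnNge; apply/negP => /hmax; by rewrite ltnn.
Qed.

Definition phi (k : nat) : R := k%:R `^ (- a) * ln k%:R `^ (d'%:R * (a + b)).

(** Replacing 2^m by [scale m] inside the power -a releases (m + 1)^(d' a), the source of a + b in
    the exponent of the logarithm. *)
Let psi_scale m : psi a (d'%:R * b) m = (scale m)%:R `^ (- a) * m.+1%:R `^ (d'%:R * (a + b)).
Proof.
rewrite /psi /scale natrM !natrX powRM ?exprn_ge0// -!powR_mulrn// -!powRrM -mulrA.
rewrite -powRD; last by rewrite pnatr_eq0 implybT.
by congr (2 `^ _ * _ `^ _); ring.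
Qed.

Lemma phi_psi : exists2 C : R, 0 < C & forall k m, (2 <= k)%N ->
  (scale m <= k < scale m.+1)%N ->
  phi k <= C * psi a (d'%:R * b) m /\ psi a (d'%:R * b) m <= C * phi k.
Proof.
(* [c1] bounds the ratio of consecutive scales, hence of [k] to [scale m]; [c2] compares ln k with m
   + 1. The term 2 / ln 2 comes from m ln 2 <= ln k and ln 2 <= ln k, the terms ln 2 + d' from the
   logarithm of [scale m.+1]. *)
pose c1 : R := (2 ^ d'.+1)%:R.
pose c2 : R := 2 / ln 2 + ln 2 + d'%:R + 1.
have ln2 : 0 < ln 2 :> R by rewrite ln_gt0// ltr1n.
have iln2 : 0 < 2 / ln 2 :> R by rewrite divr_gt0.
have d0 : 0 <= d'%:R :> R by [].
have c11 : 1 <= c1 by rewrite ler1n expn_gt0.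
have c21 : 1 <= c2 by rewrite /c2; lra.
exists (c1 `^ `|- a| * c2 `^ `|d'%:R * (a + b)|).
  by rewrite mulr_gt0// powR_gt0//; apply: lt_le_trans ltr01 _.
move=> k m k2 /andP[mk km].
have k0 : 0 < k%:R :> R by rewrite ltr0n; lia.
have s0 : 0 < (scale m)%:R :> R by rewrite ltr0n muln_gt0 !expn_gt0.
have lk0 : 0 < ln k%:R :> R by rewrite ln_gt0// ltr1n.
have ks : k%:R <= c1 * (scale m)%:R :> R.
  rewrite -natrM ler_nat; apply: (leq_trans (ltnW km)).
  have h : (m.+2 ^ d' <= 2 ^ d' * m.+1 ^ d')%N.
    by rewrite -expnMn; case: (posnP d') => [->//|?]; rewrite leq_exp2r//; lia.
  rewrite /scale ![(2 ^ _.+1)%N]expnS -mulnA.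
  rewrite -[leqRHS]mulnA leq_mul2l /= mulnCA leq_mul2l; apply/orP; right.
  exact: h.
have sk : (scale m)%:R <= c1 * k%:R :> R.
  apply: (@le_trans _ _ k%:R); first by rewrite ler_nat.
  by rewrite ler_peMl// ltW.
have lnm : m%:R * ln 2 <= ln k%:R :> R.
  rewrite mulr_natl -lnXn// ler_ln ?posrE ?exprn_gt0//.
  rewrite -natrX ler_nat; apply: leq_trans mk; rewrite /scale leq_pmulr// expn_gt0//.
have ln2k : ln 2 <= ln k%:R :> R by rewrite ler_ln ?posrE// ler_nat.
have lower : m.+1%:R <= c2 * ln k%:R :> R.
  apply: (@le_trans _ _ (2 / ln 2 * ln k%:R)); last by rewrite ler_pM2r// /c2; lra.
  rewrite mulrAC ler_pdivlMr// -natr1; lra.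
have upper : ln k%:R <= c2 * m.+1%:R :> R.
  apply: (@le_trans _ _ (ln (scale m.+1)%:R)).
    by rewrite ler_ln ?posrE// ?ltr0n ?muln_gt0 ?expn_gt0// ler_nat ltnW.
  rewrite /scale natrM !natrX lnM ?posrE ?exprn_gt0// !lnXn//.
  have h : ln m.+2%:R <= m.+1%:R :> R.
    have := @le_ln1Dx R m.+1%:R; rewrite [1 + _]addrC natr1; apply.
    by have := ler0n R m.+1; lra.
  rewrite -[_ *+ m.+1]mulr_natl -[_ *+ d']mulr_natl.
  have : d'%:R * ln m.+2%:R <= d'%:R * m.+1%:R :> R by rewrite ler_wpM2l.
  have m0 : 0 <= m.+1%:R :> R by [].
  have : 0 <= (2 / ln 2 + 1) * m.+1%:R :> R by rewrite mulr_ge0//; lra.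
  rewrite /c2 !mulrDl; lra.
have m0 : 0 < m.+1%:R :> R by [].
rewrite psi_scale /phi; split; rewrite mulrACA; apply: ler_pM; rewrite ?powR_ge0//;
  exact: powR_comparable.
Qed.

End LogarithmicScale.

(** * Entropy numbers of the two classes *)

(** The geometric growth absorbs the linear factor: this keeps the number of refinement steps from
    costing a logarithm. *)
Lemma sum_expn2_sub n : (\sum_(i < n.+1) 2 ^ i * (n - i) <= 2 ^ n.+1)%N.
Proof.
elim: n => [|n IH]; first by rewrite big_ord_recr big_ord0.
rewrite big_ord_recr /= subnn muln0 addn0.
rewrite (eq_bigr (fun i : 'I_n.+1 => 2 ^ i * (n - i) + 2 ^ i)%N); last first.
  move=> i _; have hi : (i <= n)%N by rewrite -ltnS.
  by rewrite (subSn hi) mulnS addnC.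
rewrite big_split /= [X in (_ <= X)%N]expnS mul2n -addnn leq_add//.
by have := predn_exp 2 n.+1; rewrite mul1n => <-; exact: leq_pred.
Qed.

Section Classes.
Variables (R : realType) (d' : nat) (q : \bar R) (a b : R).
Hypothesis q1 : (1 <= q)%E.
Hypothesis a0 : 0 < a.
Local Notation d := d'.+1.
Local Notation T := (d.-tuple R).
Local Notation w := (weight a (d'%:R * b)).
Local Notation ps := (psi a (d'%:R * b)).
Local Notation ph := (phi d' a b).
Implicit Types (f : T -> R[i]) (A : set (T -> R[i])).

Let w_ge0 n : 0 <= w n. Proof. exact/ltW/weight_gt0. Qed.

(** Common interface of the two classes for the upper bound: the remainder after any number of terms
    obeys the bound given by the triangle inequality for the discarded weights. *)
Definition expandable A := (forall f, A f -> Lp q f) /\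
  forall f M r, A f -> (forall n, \sum_(M <= l < M + n) w l <= r) ->
  exists t : nat -> T -> R[i], (forall n, tball q (Q_freqs d' n) (w n) (t n)) /\
    (normLp q (f - \sum_(n < M) t n)%R <= r%:E)%E.

Lemma entropy_upper A : expandable A ->
  exists2 C : R, 0 < C & forall k, (2 <= k)%N -> (entropy_Lp q A k <= (C * ph k)%:E)%E.
Proof.
move=> [AL Aexp].
pose J := (Num.truncn (a + 1)).+1.
have aJ : a + 1 <= J%:R by rewrite ltW// /J; apply: truncnS_gt.
(* The base-2 exponent of the number of centres is at most 4 * 4J * 2 * [scale m'] = 32 J
   [scale m']. Since 32 J < 2^h, lowering [m] by [h] brings it below [scale m], hence below [k]. *)
pose h := (32 * J)%N.
have [C1 C10 tail] := weight_tail (d'%:R * b) a0.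
have [C2 C20 head] := weight_head (d'%:R * b) aJ.
have [C3 C30 psub] := psi_sub (d'%:R * b) a0 h.
have [C4 C40 pp] := @phi_psi R d' a b.
pose c5 : R := 2 `^ `|d'%:R * b|.
have c50 : 0 < c5 by exact: powR2_gt0.
exists ((C2 + C1 * c5) * C3 * C4); first by rewrite !mulr_gt0// addr_gt0// mulr_gt0.
move=> k k2; have [m mk] := @scale_bracket d' k (ltnW k2).
pose m' := (m - h)%N.
have covA : covered q A (\sum_(n < m'.+1) w n * 2^-1 ^+ (J * (m' - n)) + C1 * ps m'.+1)
    (16 ^ (\sum_(n < m'.+1) (size (Q_freqs d' n) + size (Q_freqs d' n)) * (J * (m' - n)))).
  apply: (covered_sums q1 (fun n => J * (m' - n))%N) => //.
  - by move=> n; exact: undup_uniq.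
  - by move=> n; exact: weight_gt0.
  - by move=> f Af; apply: Aexp => // n; exact: tail.
have count : (16 ^ (\sum_(n < m'.+1) (size (Q_freqs d' n) + size (Q_freqs d' n)) * (J * (m' - n))) <= 2 ^ k)%N.
  (* For small [m] only layer 0 remains, with refinement 0, and a single centre suffices. *)
  have [mh|hm] := ltnP m h.
    have -> : m' = 0%N by rewrite /m'; lia.
    by rewrite big_ord_recr big_ord0 /= subnn !muln0 expn0 expn_gt0.
  rewrite -[16%N]/(2 ^ 4)%N -expnM leq_exp2l//.
  apply: (@leq_trans (32 * J * scale d' m')).
    apply: (@leq_trans (4 * (\sum_(n < m'.+1) (4 * J * m'.+1 ^ d') * (2 ^ n * (m' - n))))%N).
      rewrite leq_mul2l /=; apply: leq_sum => n _.
      have hs := size_Q_freqs d' n.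
      have hnm : (n.+1 ^ d' <= m'.+1 ^ d')%N.
        by case: (posnP d') => [->//|?]; rewrite leq_exp2r.
      have hs' : (size (Q_freqs d' n) <= m'.+1 ^ d' * (2 * 2 ^ n))%N.
        by rewrite -expnS; apply: leq_trans hs _; rewrite leq_mul2r hnm orbT.
      apply: (@leq_trans ((2 * (m'.+1 ^ d' * (2 * 2 ^ n))) * (J * (m' - n)))%N).
        by rewrite leq_mul2r addnn -mul2n leq_mul2l hs' !orbT.
      by rewrite leq_eqVlt; apply/orP; left; apply/eqP; ring.
    rewrite -big_distrr /= /scale.
    have := sum_expn2_sub m'; rewrite expnS => hg.
    apply: (@leq_trans (4 * (4 * J * m'.+1 ^ d' * (2 * 2 ^ m')))%N).
      by rewrite !leq_mul2l hg !orbT.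
    by rewrite leq_eqVlt; apply/orP; left; apply/eqP; ring.
  have /andP[sk _] := mk; apply: leq_trans sk.
  apply: (@leq_trans (2 ^ h * scale d' m')); first by rewrite leq_mul2r ltnW ?orbT// ltn_expl.
  rewrite /scale mulnA -expnD subnKC// leq_mul2l; apply/orP; right.
  by case: (posnP d') => [->//|?]; rewrite leq_exp2r// ltnS leq_subr.
apply: le_trans (covered_entropy AL (covered_leq count covA)) _.
rewrite lee_fin.
have h2 : ps m'.+1 <= c5 * ps m'.
  apply: le_trans (psi_le_right _ _ (leqnSn m')) _.
  rewrite subSnn mulr1 ler_pM2r ?psi_gt0// -[leRHS]mul1r ler_pM2r//.
  by rewrite powRN invf_le1 ?powR2_gt0// -[leLHS](powRr0 2) ler_powR ?ler1n// ltW.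
apply: (@le_trans _ _ ((C2 + C1 * c5) * ps m')).
  by rewrite mulrDl lerD ?head// -mulrA ler_pM2l.
have C50 : 0 < C2 + C1 * c5 by rewrite addr_gt0// mulr_gt0.
rewrite -!mulrA ler_pM2l//; apply: le_trans (psub m) _.
by rewrite ler_pM2l//; have [] := pp k m k2 mk.
Qed.

Lemma normLp_sum (s : seq nat) (g : nat -> T -> R[i]) (v : nat -> R) :
  (forall n, cmeasurable (g n)) -> (forall n, n \in s -> (normLp q (g n) <= (v n)%:E)%E) ->
  (normLp q (\sum_(n <- s) g n)%R <= (\sum_(n <- s) v n)%:E)%E.
Proof.
move=> mg; elim: s => [|n s IH] gv; first by rewrite !big_nil normLp0.
rewrite !big_cons EFinD; apply: le_trans (normLpD q1 (mg n) _) _.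
  by elim/big_ind : _ => [|g1 g2|l _//]; [exact: cmeasurable_cst|exact: cmeasurableD].
by apply: leeD; [apply: gv; rewrite mem_head|apply: IH => l ls; apply: gv; rewrite inE ls orbT].
Qed.

Lemma tpoly_freqs_Q n c : exists c', tpoly (freqs d' n) c = tpoly (Q_freqs d' n) c' :> (T -> R[i]).
Proof.
exists (fun k => if k \in freqs d' n then c k else 0); apply/funext => x; rewrite /tpoly.
transitivity (\sum_(k <- Q_freqs d' n | k \in freqs d' n) c k * cexpi (dot k x)); last first.
  by rewrite big_mkcond; apply: eq_bigr => k _; case: ifP => // _; rewrite mul0r.
rewrite -[RHS]big_filter; apply: perm_big; apply: uniq_perm; first exact: uniq_freqs.
  by rewrite filter_uniq// undup_uniq.
move=> k; rewrite mem_filter; case: (boolP (k \in _)) => //= kn; apply/esym/mem_Q_freqs.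
by have /mem_freqs[s sn ks] := kn; exists s => //=; rewrite sn.
Qed.

(** A layer a bounded distance above [m] already has real dimension larger than [k], and its weight
    is still comparable to that at [m]. *)
Lemma entropy_lower A : (forall n, (0 < n)%N -> tball q (freqs d' n) (w n) `<=` A) ->
  exists2 C : R, 0 < C & forall k, (2 <= k)%N -> ((ph k)%:E <= C%:E * entropy_Lp q A k)%E.
Proof.
move=> bA.
(* The count of levels loses a factor d^(d-1), which 2^h recovers because d < 2^d; the doubling from
   complex to real dimension accounts for the step from 2^m to 2^(m+1). *)
pose h := (d * d)%N.
have [C1 C10 padd] := psi_add a (d'%:R * b) h.
have [C2 C20 pp] := @phi_psi R d' a b.
pose c : R := 2 `^ `|d'%:R * b|.
have c0 : 0 < c by exact: powR2_gt0.
exists (C2 * C1 * c * 6); first by rewrite !mulr_gt0.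
move=> k k2; have [m mk] := @scale_bracket d' k (ltnW k2).
have n0 : (0 < m + h)%N by rewrite addn_gt0 orbT.
have size_n : (k < size (freqs d' (m + h)) + size (freqs d' (m + h)))%N.
  have /andP[_ km] := mk; apply: leq_trans km _.
  rewrite addnn -mul2n size_freqs /scale.
  have hl := size_levels_ge d' (m + h).
  suff : (m.+2 ^ d' * 2 ^ m <= ((m + h) %/ d).+1 ^ d' * 2 ^ (m + h))%N.
    rewrite expnS -mulnA leq_mul2l /= mulnC => hs; apply: leq_trans hs _.
    by rewrite leq_mul2r hl orbT.
  have md : (m.+2 <= d * ((m + h) %/ d).+1)%N.
    have := ltn_ceil (m + h) (ltn0Sn d'); rewrite mulnC /h => hc.
    by rewrite mulnC; nia.
  apply: (@leq_trans (d ^ d' * ((m + h) %/ d).+1 ^ d' * 2 ^ m)%N).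
    rewrite leq_mul2r -expnMn; apply/orP; right.
    by case: (posnP d') => [->//|?]; rewrite leq_exp2r.
  rewrite [(d ^ d' * _)%N]mulnC -mulnA leq_mul2l; apply/orP; right.
  rewrite addnC expnD leq_mul2r; apply/orP; right.
  apply: (@leq_trans ((2 ^ d) ^ d')%N); last by rewrite -expnM leq_exp2l// leq_mul2l leqnSn orbT.
  by case: (posnP d') => [->//|?]; rewrite leq_exp2r// ltnW// ltn_expl.
have wn := weight_gt0 a (d'%:R * b) (m + h).
have ent := @tball_entropy_ge R d q q1 _ (@uniq_freqs d' (m + h)) _ _ k wn (bA _ n0) size_n.
apply: (@le_trans _ _ ((C2 * C1 * c * 6)%:E * (w (m + h) / 6)%:E)%E); last first.
  by apply: lee_wpmul2l => //; rewrite lee_fin !mulr_ge0// ltW.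
rewrite -EFinM lee_fin.
have -> : C2 * C1 * c * 6 * (w (m + h) / 6) = C2 * (C1 * (c * w (m + h))) by field.
have [h1 _] := pp k m k2 mk; apply: le_trans h1 _.
rewrite ler_pM2l//; apply: le_trans (padd m) _; rewrite ler_pM2l//.
exact: psi_le_weight.
Qed.

Lemma weight_WE l : 2 `^ (- (a * l%:R)) * (maxn l 1)%:R `^ ((d%:R - 1) * b) = w l.
Proof. by rewrite -[d%:R]natr1 addrK. Qed.

Lemma weight_WbarE n : (0 < n)%N -> 2 `^ (- (a * n%:R)) * n%:R `^ (b * (d%:R - 1)) = w n.
Proof. by move=> n0; rewrite -[d%:R]natr1 addrK [b * _]mulrC /weight (maxn_idPl n0). Qed.

Lemma sum_weight_bounded : exists C : R, forall n, \sum_(l < n) w l <= C.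
Proof.
have [C C0 hC] := weight_tail (d'%:R * b) a0.
by exists (C * ps 0) => n; have := hC 0%N n; rewrite add0n big_mkord.
Qed.

Lemma W_expandable : expandable (W a b q).
Proof.
have [C hC] := sum_weight_bounded.
have key f : W a b q f -> Lp 1%E f /\ forall l, (normLp q (layer l f) <= (w l)%:E)%E.
  by move=> [fL fW]; split=> // l; rewrite -weight_WE.
split=> [f /key[fL fW]|f M r /key[fL fW] hr].
  have [pf mf _] := fL; split=> //.
  (* With no layer removed the remainder is [f] itself, so this puts the merely integrable [f] into
     L_q. *)
  have := @layer_tail R d' q f _ C q1 fL fW hC 0%N C.
  rewrite big_ord0 subr0 => h; apply: (@le_lt_trans _ _ C%:E); last by rewrite ltry.
  by apply: h => n; rewrite add0n big_mkord.
exists (fun n => layer n f); split=> [n|]; last exact: layer_tail hC _ _ hr.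
split; last exact: fW.
by rewrite layerE; exact: tpoly_freqs_Q.
Qed.

Lemma Wbar_expandable : expandable (Wbar a b q).
Proof.
split=> [f []//|f M r [[pf mf fy] [t [tQ cv]]] hr].
(* The class leaves [t 0] unconstrained since its series starts at 1; zero takes that place in a sum
   starting at 0. *)
pose t' n := if n is 0 then 0 else t n.
have t'E n : tball q (Q_freqs d' n) (w n) (t' n).
  case: n => [|n].
    split; last by rewrite normLp0// lee_fin.
    by exists (fun=> 0); apply/funext => x; rewrite /tpoly big1// => k _; rewrite mul0r.
  by have [/trig_polyE ht nt] := tQ n.+1 isT; split=> //; rewrite -weight_WbarE.
exists t'; split=> //.
have mt n : cmeasurable (t' n) by have [[c ->] _] := t'E n; exact: cmeasurable_tpoly.
have mS (s : seq nat) : cmeasurable (\sum_(n <- s) t' n).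
  by elim/big_ind : _ => [|g1 g2|l _//]; [exact: cmeasurable_cst|exact: cmeasurableD].
have partial m : \sum_(1 <= n < m.+1) t n = \sum_(0 <= n < m.+1) t' n.
  rewrite [RHS]big_nat_recl// [t' 0]/(0) add0r big_add1.
  by apply: eq_bigr.
(* The remainder is split at a late partial sum: the finite block is bounded by the weights, and the
   rest is below an arbitrary [e] by convergence. *)
apply/lee_addgt0Pr => e e0.
have /fine_cvgP[fin_n cvn] := cv.
have /cvgrPdist_lt/(_ _ e0) := cvn.
have : \forall m \near \oo, (M <= m)%N by exists M.
move=> near1 near2.
have [m [[Mm hm] fm]] := filter_ex (filterI (filterI near1 near2) fin_n).
have close : (normLp q (f - \sum_(0 <= n < m.+1) t' n)%R <= e%:E)%E.
  rewrite -partial -[leLHS]fineK// lee_fin; apply/ltW.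
  by apply: le_lt_trans hm; rewrite sub0r normrN ler_norm.
have -> : f - \sum_(n < M) t' n =
    \sum_(M <= n < m.+1) t' n + (f - \sum_(0 <= n < m.+1) t' n).
  rewrite -(big_mkord xpredT t') (@big_cat_nat _ _ _ M 0 m.+1)//=; last exact: leqW.
  by rewrite opprD [RHS]addrC !addrA subrK.
apply: le_trans (normLpD q1 _ _) _; [exact: mS|exact: cmeasurableB|].
apply: leeD => //; apply: le_trans (normLp_sum mt (fun n _ => proj2 (t'E n))) _.
by rewrite lee_fin; have := hr (m.+1 - M)%N; rewrite subnKC// leqW.
Qed.

(** By orthogonality and disjointness of the layers, such an [f] is its own n-th layer and its other
    layers vanish. *)
Lemma W_ball n : tball q (freqs d' n) (w n) `<=` W a b q.
Proof.
move=> f [[c fE] fn]; split; first by rewrite fE; exact: tpoly_Lp.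
move=> l; rewrite weight_WE layerE.
have [<-|ln] := eqVneq n l.
  rewrite (_ : tpoly _ _ = f)// fE; apply/funext => x; apply: eq_big_seq => k kn.
  by rewrite fourier_coef_tpoly ?uniq_freqs// kn.
rewrite (_ : tpoly _ _ = 0) ?normLp0 ?lee_fin//.
apply/funext => x; rewrite /tpoly big_seq big1// => k kl.
rewrite fE fourier_coef_tpoly ?uniq_freqs// ifF ?mul0r//.
by apply/negbTE/negP => kn; case/eqP: ln; exact: freqs_disjoint kn kl.
Qed.

Lemma Wbar_ball n : (0 < n)%N -> tball q (freqs d' n) (w n) `<=` Wbar a b q.
Proof.
move=> n0 f [[c fE] fn]; split; first by rewrite fE; exact: tpoly_Lp.
exists (fun m => if m == n then f else 0); split=> [m m0|].
  rewrite weight_WbarE//; have [->|_] := eqVneq m n; split=> //.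
  - by apply/trig_polyE; rewrite fE; exact: tpoly_freqs_Q.
  - apply/trig_polyE; exists (fun=> 0); apply/funext => x.
    by rewrite /tpoly big1// => k _; rewrite mul0r.
  - by rewrite normLp0// lee_fin.
apply: cvg_near_cst; exists n => // m /= nm.
rewrite -big_mkcond big_nat1_eq /=.
by rewrite n0 ltnS nm subrr normLp0.
Qed.

(** The upper bound for one class and the lower bound for the other meet in [phi]; no inclusion
    between the classes is involved. *)
Lemma classes_equivalent A B : expandable A -> (forall n, (0 < n)%N -> tball q (freqs d' n) (w n) `<=` B) ->
  dominated_from 2 (entropy_Lp q A) (entropy_Lp q B).
Proof.
move=> /entropy_upper[C C0 hC] /entropy_lower[D D0 hD]; exists (C * D); split; first exact: mulr_gt0.
move=> k k2; apply: le_trans (hC k k2) _; rewrite !EFinM -muleA.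
by apply: lee_wpmul2l; [rewrite lee_fin ltW|exact: hD].
Qed.

End Classes.

Theorem theorem1p7 (R : realType) (d : nat) (q : \bar R) (a b : R) :
  (2 <= d)%N -> (1 <= q)%E -> 0 < a ->
  equivalent_from 2
    (entropy_Lp q (@W R d a b q)) (entropy_Lp q (@Wbar R d a b q)) /\
  equivalent_from 2
    (entropy_Lp q (@Wbar R d a b q))
    (fun k : nat =>
       (k%:R `^ (- a) * ln k%:R `^ ((d%:R - 1) * (a + b)))%:E).
Proof.
case: d => // d' _ q1 a0.
have WW := W_expandable d' b q1 a0; have Wb := @Wbar_expandable R d' q a b q1.
have bW n (_ : (0 < n)%N) := @W_ball R d' q a b q1 n.
have bWb := @Wbar_ball R d' q a b q1.
split; split.
- exact: classes_equivalent q1 a0 _ _ WW bWb.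
- exact: classes_equivalent q1 a0 _ _ Wb bW.
- have [C C0 hC] := entropy_upper q1 a0 Wb.
  by exists C; split=> // k k2; rewrite -EFinM -[d'.+1%:R]natr1 addrK; exact: hC.
- have [C C0 hC] := entropy_lower q1 a0 bWb.
  by exists C; split=> // k k2; rewrite -[d'.+1%:R]natr1 addrK; exact: hC.
Qed.
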